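(* Let $N\ge 1$ be an integer, $\sigma\in\{0,1\}$, and let $M_1,M_2$ be integers; put $M_{12}=M_1-M_2$. Let $L_1,L_2$ be such that $L_1+\frac{M_{12}+\sigma}{2}$ and $L_2+\frac{M_{12}+\sigma}{2}$ are integers, and assume that $M_{12}+\sigma N$ is even. Let $p,p',r,s$ be integers with $p'>p\ge 1$. Assume that $$ \left\lfloor\frac{L_1+M_{12}\frac{N-1}{2N}-s-\frac rN}{p'+\frac pN}\right\rfloor\le\left\lfloor\frac{L_1+M_{12}+r-s}{p'-p}\right\rfloor,\qquad \left\lfloor\frac{L_2-M_{12}\frac{N-1}{2N}+s+\frac rN}{p'+\frac pN}\right\rfloor\le\left\lfloor\frac{L_2-M_{12}-r+s}{p'-p}\right\rfloor, $$ and also that the two inequalities obtained from these by setting $r=s=0$ hold, i.e. $$ \left\lfloor\frac{L_1+M_{12}\frac{N-1}{2N}}{p'+\frac pN}\right\rfloor\le\left\lfloor\frac{L_1+M_{12}}{p'-p}\right\rfloor,\qquad \left\lfloor\frac{L_2-M_{12}\frac{N-1}{2N}}{p'+\frac pN}\right\rfloor\le\left\lfloor\frac{L_2-M_{12}}{p'-p}\right\rfloor . $$ Then $$ X^{(p,p+Np'),N}_{r,r+Ns,\sigma}(M_1,L_1,M_2,L_2) =\sum_{i\in\mathbb{Z}}q^{i(i+M_{12})/N}\genfrac{[}{]}{0pt}{}{L_1+L_2+M_2-i}{M_2-i} \sum_{\substack{n\in\mathbb{Z}^{N-1}\\ \frac{2i+M_{12}+\sigma N}{2N}+(C^{-1}n)_1\in\mathbb{Z}}}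 q^{nC^{-1}n}\genfrac{[}{]}{0pt}{}{m+n}{n}\, X^{(p,p')}_{r,s}\bigl(i+M_{12},\,L_1-i+\tfrac12m_1,\,i,\,L_2-M_{12}-i+\tfrac12m_1\bigr), $$ where on the right-hand side $m$ is determined by $n$ and $i$ through $m+n=\frac12(\mathcal{I}m+(2i+M_{12})e_1)$.
   Context: $(q)_k=\prod_{j=1}^k(1-q^j)$ for $k\ge0$. The $q$-binomial coefficient is $\genfrac{[}{]}{0pt}{}{a+b}{a}=\frac{(q)_{a+b}}{(q)_a(q)_b}$ if $a,b\ge0$ are integers and $0$ otherwise; in particular $\genfrac{[}{]}{0pt}{}{t}{k}=0$ unless $0\le k\le t$. $C$ is the Cartan matrix of $A_{N-1}$: $C_{ij}=2\delta_{i,j}-\delta_{|i-j|,1}$ for $i,j=1,\dots,N-1$; $\mathcal{I}=2I-C$; $e_1,\dots,e_{N-1}$ are the standard unit vectors of $\mathbb{Z}^{N-1}$; $nC^{-1}n=\sum_{i,j}n_iC^{-1}_{ij}n_j$; for vectors $\genfrac{[}{]}{0pt}{}{m+n}{n}=\prod_{j=1}^{N-1}\genfrac{[}{]}{0pt}{}{m_j+n_j}{n_j}$. **Polynomials $X$.** For integers $p,p'\ge1$, $r,s$ and integers $M_1,L_1,M_2,L_2$, with $M_{12}=M_1-M_2$, $$ X^{(p,p')}_{r,s}(M_1,L_1,M_2,L_2)=\sum_{j=-\infty}^{\infty}\Bigl\{q^{j(pp'j+p'(M_{12}+r)-ps)}\genfrac{[}{]}{0pt}{}{M_1+L_1-(p'-p)j}{M_1+pj}\genfrac{[}{]}{0pt}{}{M_2+L_2+(p'-p)j}{M_2-pj}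 $$ $$ -q^{(pj+M_{12}+r)(p'j+s)}\genfrac{[}{]}{0pt}{}{M_1+L_1-(p'-p)j+r-s}{M_1+pj+r}\genfrac{[}{]}{0pt}{}{M_2+L_2+(p'-p)j-r+s}{M_2-pj-r}\Bigr\}. $$ **Polynomials $X^{\cdot,N}$.** Let $N$ be a positive integer, $\sigma\in\{0,1\}$, $M_1,M_2,L_1+\frac{M_{12}+\sigma}{2},L_2+\frac{M_{12}+\sigma}{2}$ integers with $M_{12}+\sigma N$ even, and let $P\ge1$, $P'$, $R$, $S$ be integers such that $(P'-P)/N$ is a nonnegative integer and $(R-S)/N\in\mathbb{Z}$. Then $$ X^{(P,P'),N}_{R,S,\sigma}(M_1,L_1,M_2,L_2)= \sum_{j=-\infty}^{\infty}q^{\frac jN(PP'j+P'(M_{12}+R)-PS)} \sum_{\substack{\eta\in\mathbb{Z}^{N-1}\\ \frac{M_{12}+2Pj+\sigma N}{2N}+(C^{-1}\eta)_1\in\mathbb{Z}}}q^{\eta C^{-1}\eta}\genfrac{[}{]}{0pt}{}{\eta+\mu}{\eta} $$ $$ \times\genfrac{[}{]}{0pt}{}{M_1+L_1-(P'-P)j/N-\frac12(M_2-Pj-\mu_1)}{M_1+Pj}\genfrac{[}{]}{0pt}{}{M_2+L_2+(P'-P)j/N-\frac12(M_1+Pj-\mu_{N-1})}{M_2-Pj} $$ $$ -\sum_{j=-\infty}^{\infty}q^{\frac1N(Pj+M_{12}+R)(P'j+S)} \sum_{\substack{\eta\in\mathbb{Z}^{N-1}\\ \frac{M_{12}+2Pj+2R+\sigma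 N}{2N}+(C^{-1}\eta)_1\in\mathbb{Z}}}q^{\eta C^{-1}\eta}\genfrac{[}{]}{0pt}{}{\eta+\mu}{\eta} $$ $$ \times\genfrac{[}{]}{0pt}{}{M_1+L_1-((P'-P)j-R+S)/N-\frac12(M_2-Pj-R-\mu_1)}{M_1+Pj+R} \genfrac{[}{]}{0pt}{}{M_2+L_2+((P'-P)j-R+S)/N-\frac12(M_1+Pj+R-\mu_{N-1})}{M_2-Pj-R}, $$ where $\mu$ is determined by $\eta$ and $j$ through $\mu+\eta=\frac12(\mathcal{I}\mu+(M_1+Pj)e_1+(M_2-Pj)e_{N-1})$ in the first sum and through $\mu+\eta=\frac12(\mathcal{I}\mu+(M_1+Pj+R)e_1+(M_2-Pj-R)e_{N-1})$ in the second sum. Convention for $N=1$: the sums over $n$ and $\eta$ and the corresponding factors drop out, $m_1=0$, and $\mu_1$, $\mu_{N-1}=\mu_0$ are read as $M_2-Pj$, $M_1+Pj$ in the first sum and as $M_2-Pj-R$, $M_1+Pj+R$ in the second sum. Fractional powers of $q$ are formal (or use a fixed consistent choice of roots). *)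

(* Defs.v *)
From mathcomp Require Import all_boot all_order all_algebra.
From mathcomp Require Import boolp classical_sets fsbigop.
From mathcomp Require Import zify ring lra.

Set Implicit Arguments.
Unset Strict Implicit.
Unset Printing Implicit Defensive.

Import Order.TTheory GRing.Theory Num.Theory.
Local Open Scope classical_set_scope.
Local Open Scope ring_scope.

(* Sums over int and over integer vectors are the finitely supported sums
   [\sum_(x \in A) F x] of fsbigop, which are 0 by default when the support is
   infinite.  All the supports below are finite when p, P >= 1.  The lower
   entries M1 + pj and M2 - pj (or their shifts by r) must be nonnegative, which
   bounds j, and also i when M1 = i + M12 and M2 = i; i is bounded above by the
   lower entry M2 - i.  In a vector sum over n >= 0 with
   m = C^-1 (w - 2 n) >= 0, n is bounded because C^-1 has positive entries. *)

(* Formal q^(1/N) is the indeterminate of the field of rational functions. *)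
Definition qfield := {fraction {poly rat}}.
Definition qroot : qfield := tofrac 'X.

(* q ^ e for e in (1/N)Z, which contains all the exponents occurring below
   (the entries of N C^-1 are integers); N * e is then an integer, equal to its
   numerator. *)
Definition qpow (N : nat) (e : rat) : qfield := qroot ^ numq (N%:Q * e).

Definition qpoch (N k : nat) : qfield :=
  \prod_(1 <= j < k.+1) (1 - qpow N j%:Q).

(* Arguments are rational: the binomial is 0 unless k and t - k are both
   nonnegative integers. *)
Definition qbinom (N : nat) (t k : rat) : qfield :=
  if (k \is a Num.nat) && (t - k \is a Num.nat) then
    qpoch N (Num.truncn t) / (qpoch N (Num.truncn k) * qpoch N (Num.truncn (t - k)))
  else 0.

(* Vectors of length n = N - 1 are columns; components are numbered from 1. *)
Definition unitvec (n k : nat) : 'cV[rat]_n := \col_(i < n) (i.+1 == k)%:R.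

(* The k-th component, 0 if there is none (in particular if n = 0). *)
Definition component (n : nat) (v : 'cV[rat]_n) (k : nat) : rat :=
  \sum_(i < n | i.+1 == k) v i 0.

Definition cartan (n : nat) : 'M[rat]_n :=
  \matrix_(i, j) (2%:R * (i == j)%:R - ((i.+1 == j :> nat) || (j.+1 == i :> nat))%:R).

Lemma sum_delta_ord (n k : nat) (f : nat -> rat) :
  \sum_(j < n) (k == j :> nat)%:R * f j = (k < n)%:R * f k.
Proof.
have [kn|nk] := ltnP k n.
  rewrite (bigD1 (Ordinal kn)) //= eqxx big1 ?addr0 // => j /eqP nj.
  by case: eqP => [e|_]; [case: nj; apply: val_inj | rewrite mul0r].
rewrite mul0r big1 // => j _; case: eqP => [e|_]; last by rewrite mul0r.
by have := ltn_ord j; rewrite -e ltnNge nk.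
Qed.

Lemma sum_cartan (n : nat) (i : 'I_n) (f : nat -> rat) :
  f 0%N = 0 -> f n.+1 = 0 ->
  \sum_(j < n) cartan n i j * f j.+1 = 2%:R * f i.+1 - f i - f i.+2.
Proof.
move=> f0 fn; pose g k := f k.+1.
transitivity (2%:R * \sum_(j < n) (i == j :> nat)%:R * g j
  - \sum_(j < n) (i.+1 == j :> nat)%:R * g j
  - \sum_(j < n) (i == j.+1 :> nat)%:R * f j.+1).
  rewrite mulr_sumr -!sumrB; apply: eq_bigr => j _.
  rewrite !mxE /g -val_eqE /= (eq_sym j.+1).
  by case: eqP => e1; case: eqP => e2; case: eqP => e3 /=; try lia; ring.
rewrite !sum_delta_ord ltn_ord mul1r.
have -> : (i.+1 < n)%:R * g i.+1 = f i.+2.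
  have [|le] := ltnP i.+1 n; first by rewrite mul1r.
  by rewrite mul0r (_ : i.+2 = n.+1) ?fn //; have := ltn_ord i; lia.
have -> : \sum_(j < n) (i == j.+1 :> nat)%:R * f j.+1 = f i.
  have := sum_delta_ord n.+1 i f; rewrite big_ord_recl f0 mulr0 add0r => ->.
  by rewrite ltnS ltnW ?ltn_ord ?mul1r.
by rewrite /g; ring.
Qed.

Lemma cartan_unitmx (n : nat) : cartan n \in unitmx.
Proof.
pose B : 'M[rat]_n :=
  \matrix_(j, k) ((minn j.+1 k.+1)%:R - (j.+1 * k.+1)%:R / n.+1%:R).
suff CB : cartan n *m B = 1%:M by case: (mulmx1_unit CB).
apply/matrixP => i k; rewrite !mxE.
pose f m : rat := (minn m k.+1)%:R - (m * k.+1)%:R / n.+1%:R.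
rewrite (eq_bigr (fun j : 'I_n => cartan n i j * f j.+1)); last first.
  by move=> j _; rewrite [B _ _]mxE.
rewrite sum_cartan; first last.
- rewrite /f (minn_idPr _); last by rewrite ltnS ltnW.
  by rewrite natrM mulrAC divff ?mul1r ?subrr // pnatr_eq0.
- by rewrite /f min0n mul0n mul0r subrr.
rewrite /f -val_eqE /= !mulSn !natrD.
have lin : 2%:R * (minn i.+1 k.+1)%:R - (minn i k.+1)%:R - (minn i.+2 k.+1)%:R
    = (i == k :> nat)%:R :> rat.
  case: (ltngtP i k) => h.
  - by rewrite !(minn_idPl _) ?[i.+2%:R]mulrS ?[i.+1%:R]mulrS /=; try lia; ring.
  - by rewrite !(minn_idPr _) /=; try lia; ring.
  - rewrite h minnn (minn_idPl (leqnSn k)) (minn_idPr (leqnSn k.+1)).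
    by rewrite mulrS /=; ring.
rewrite -lin; field; by rewrite addrC natr1 pnatr_eq0.
Qed.

Definition incidence (n : nat) : 'M[rat]_n := 2%:R *: 1%:M - cartan n.

Definition ratvec (n : nat) (v : 'cV[int]_n) : 'cV[rat]_n := map_mx intr v.

Definition quadform (n : nat) (v : 'cV[int]_n) : rat :=
  ((ratvec v)^T *m invmx (cartan n) *m ratvec v) 0 0.

Definition cartan_inv_1 (n : nat) (v : 'cV[int]_n) : rat :=
  component (invmx (cartan n) *m ratvec v) 1.

Definition qbinom_vec (N n : nat) (t k : 'cV[rat]_n) : qfield :=
  \prod_(j < n) qbinom N (t j 0) (k j 0).

(* The solution m of m + v = (I m + w) / 2; see mvecP. *)
Definition mvec (n : nat) (w : 'cV[rat]_n) (v : 'cV[int]_n) : 'cV[rat]_n :=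
  xget 0 [set m | m + ratvec v = 2%:R^-1 *: (incidence n *m m + w)].

Lemma mvecP (n : nat) (w : 'cV[rat]_n) (v : 'cV[int]_n) (m : 'cV[rat]_n) :
  m + ratvec v = 2%:R^-1 *: (incidence n *m m + w) <-> m = mvec w v.
Proof.
have eqE x : (x + ratvec v = 2%:R^-1 *: (incidence n *m x + w)) <->
    x = invmx (cartan n) *m (w - 2%:R *: ratvec v).
  rewrite /incidence mulmxBl -scalemxAl mul1mx.
  have -> : x = invmx (cartan n) *m (w - 2%:R *: ratvec v) <->
            cartan n *m x = w - 2%:R *: ratvec v.
    by split=> [->|<-]; rewrite ?mulKmx ?mulKVmx ?cartan_unitmx.
  by split=> /colP e; apply/colP => i; have := e i; rewrite !mxE; lra.
rewrite /mvec; split => [/eqE->|->]; last first.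
  case: xgetP => [? -> //|] /(_ (invmx (cartan n) *m (w - 2%:R *: ratvec v))).
  by move=> h; case: h; apply/eqE.
by case: xgetP => [? -> /eqE->//|] /(_ (invmx (cartan n) *m (w - 2%:R *: ratvec v))) [];
  apply/eqE.
Qed.

(* X^{(p,p')}_{r,s}(M1,L1,M2,L2); the L's are rational since they are given as
   such where X is used. *)
Definition Xpoly (N : nat) (p p' r s : int) (M1 : int) (L1 : rat)
    (M2 : int) (L2 : rat) : qfield :=
  let M12 := M1 - M2 in
  \sum_(j \in [set: int])
    (qpow N (j * (p * p' * j + p' * (M12 + r) - p * s))%:Q
       * qbinom N (M1%:Q + L1 - ((p' - p) * j)%:Q) (M1 + p * j)%:Q
       * qbinom N (M2%:Q + L2 + ((p' - p) * j)%:Q) (M2 - p * j)%:Q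
     - qpow N ((p * j + M12 + r) * (p' * j + s))%:Q
       * qbinom N (M1%:Q + L1 - ((p' - p) * j)%:Q + (r - s)%:Q)
           (M1 + p * j + r)%:Q
       * qbinom N (M2%:Q + L2 + ((p' - p) * j)%:Q - (r - s)%:Q)
           (M2 - p * j - r)%:Q).

(* The sum over eta in X^{(P,P'),N}: (a, b) is (M1 + Pj, M2 - Pj) or
   (M1 + Pj + R, M2 - Pj - R), so that a - b is M12 + 2Pj or M12 + 2Pj + 2R,
   and t1, t2 are the parts of the upper entries not involving mu.  For N = 1
   the sum reduces to eta = 0, with mu_1 and mu_{N-1} read as b and a. *)
Definition Xinner (N : nat) (sigma a b : int) (t1 t2 : rat) : qfield :=
  let n := N.-1 in
  \sum_(eta \in [set eta : 'cV[int]_n |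
      (a - b + sigma * N%:Z)%:Q / (2 * N)%:Q + cartan_inv_1 eta
        \is a Num.int])
    (let mu := mvec (a%:Q *: unitvec n 1 + b%:Q *: unitvec n n) eta in
     let mu1 := if N == 1%N then b%:Q else component mu 1 in
     let muN1 := if N == 1%N then a%:Q else component mu n in
     qpow N (quadform eta) * qbinom_vec N (ratvec eta + mu) (ratvec eta)
       * qbinom N (t1 - (b%:Q - mu1) / 2%:R) a%:Q
       * qbinom N (t2 - (a%:Q - muN1) / 2%:R) b%:Q).

(* X^{(P,P'),N}_{R,S,sigma}(M1,L1,M2,L2) *)
Definition XNpoly (P P' : int) (N : nat) (R S sigma : int) (M1 : int)
    (L1 : rat) (M2 : int) (L2 : rat) : qfield :=
  let M12 := M1 - M2 in
  \sum_(j \in [set: int])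
    (qpow N (j%:Q / N%:Q * (P * P' * j + P' * (M12 + R) - P * S)%:Q)
     * Xinner N sigma (M1 + P * j) (M2 - P * j)
         (M1%:Q + L1 - ((P' - P) * j)%:Q / N%:Q)
         (M2%:Q + L2 + ((P' - P) * j)%:Q / N%:Q))
  - \sum_(j \in [set: int])
    (qpow N (((P * j + M12 + R) * (P' * j + S))%:Q / N%:Q)
     * Xinner N sigma (M1 + P * j + R) (M2 - P * j - R)
         (M1%:Q + L1 - ((P' - P) * j - R + S)%:Q / N%:Q)
         (M2%:Q + L2 + ((P' - P) * j - R + S)%:Q / N%:Q)).

(* Main.v *)
Require Import Defs.
From mathcomp Require Import all_boot all_order all_algebra.
From mathcomp Require Import boolp classical_sets fsbigop.
From mathcomp Require Import zify ring lra.
Set Implicit Arguments.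
Unset Strict Implicit.
Unset Printing Implicit Defensive.
Import Order.TTheory GRing.Theory Num.Theory.
Local Open Scope classical_set_scope.
Local Open Scope ring_scope.

(** Write N = n + 1.  A vector eta of Z^(N-1) with boundary data (a, b) is
turned into a path: mu = C^-1 (a e_1 + b e_(N-1) - 2 eta) is extended by
mu_0 = a and mu_N = b, so that 2 eta_j = mu_(j-1) - 2 mu_j + mu_(j+1)
([mvec_extend]).  Then [eta_j + mu_j; eta_j] is the q-binomial coefficient
[(mu_(j-1) + mu_(j+1)) / 2; mu_j], the form eta C^-1 eta is the sum of the
(mu_(j-1) - mu_j)^2 / 4 minus (a - b)^2 / (4 N) ([quadformE]), and the
congruence on (C^-1 eta)_1 says that every step mu_(j-1) - mu_j has the parity
of sigma.  The sums over eta and over n become sums over paths from a to b, and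
over paths from 2 i + M12 to 0, with a weight that only involves consecutive
entries ([vector_sum_path]).

The theorem holds term by term in j.  With k = p j in the first sum, k = p j + r
in the second, put a = M1 + k and b = M2 - k.  Put A = L1 + M12 - (p' - p) j and
B = L2 - M12 + (p' - p) j in the first sum, and add r - s to A and s - r to B in
the second.  After a shift of i by k the j-th terms agree by the following
identity, whose case N = 1 is the q-Saalschuetz sum ([generalized_saalschutz]):

  sum_eta q^(eta C^-1 eta) [eta + mu; eta] [A + (b + mu_1) / 2; a]
      [B + (a + mu_(N-1)) / 2; b]
  = sum_i q^(i (i + a - b) / N) [A + B + b - i; b - i]
      sum_n q^(n C^-1 n) [m + n; n] [A + m_1 / 2; i + a - b] [B + m_1 / 2; i].

On paths this is [path_sum_descent], proved by induction on N.  Reversing the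
paths exchanges a and b, so b <= a may be assumed.  The first step of a path
from a to b is split off, and the induction hypothesis turns the remaining path
into a path that descends to 0.  Once that path is fixed, a single summation is
left on each side; the two sums are related by the terminating transformation of
Sears for 4phi3 series ([step_exchange], [sears_symmetry]), which follows by
expanding a sum of four q-binomial coefficients in two ways with the
q-Vandermonde formula.

The identity may fail when A or B is negative.  The convexity of the paths bounds
mu_1, mu_(N-1) and m_1, and the hypotheses on the floors imply that A and B are
nonnegative for every j for which one of the two sides can be nonzero
([Xinner_neq0], [saalschutz_term_neq0], [branch_nonneg_l], [branch_nonneg_r]). *)

(** * q-binomial coefficients and a transformation of Sears *)

Section QBinomials.
Variables (F : fieldType) (q : F).
Hypothesis q_neq0 : q != 0.
Hypothesis q_not_root1 : forall n, q ^+ n.+1 != 1.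
Implicit Types (t k l x y : int).

(** The product formula, which makes sense for negative upper entries; the
expansions behind [sears_symmetry] produce such entries even when all the
entries of the sum are nonnegative. *)
Definition qbin (t k : int) : F :=
  if k is Posz n then \prod_(j < n) ((1 - q ^ (t - j%:Z)) / (1 - q ^+ j.+1))
  else 0.

Local Arguments qbin : simpl never.

Lemma qbin0 t : qbin t 0 = 1.
Proof. exact: big_ord0. Qed.

Lemma qbin_neg t k : k < 0 -> qbin t k = 0.
Proof. by case: k. Qed.

Lemma qbin_small t k : 0 <= t < k -> qbin t k = 0.
Proof.
case: t k => [t|//] [k|//] /andP[_]; rewrite ltz_nat => tk.
by rewrite /qbin (bigD1 (Ordinal tk)) //= subrr expr0z subrr !mul0r.
Qed.

Lemma qdenom n : 1 - q ^+ n.+1 != 0.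
Proof. by rewrite subr_eq0 eq_sym. Qed.

Lemma qbinS t (n : nat) :
  qbin t n.+1 = qbin t n * ((1 - q ^ (t - n%:Z)) / (1 - q ^+ n.+1)).
Proof. by rewrite /qbin big_ord_recr. Qed.

Lemma qbin_absorb t (n : nat) :
  qbin (t + 1) n.+1 = qbin t n * ((1 - q ^ (t + 1)) / (1 - q ^+ n.+1)).
Proof.
elim: n => [|n IH]; first by rewrite qbinS !qbin0 subr0.
rewrite qbinS IH qbinS (_ : t + 1 - n.+1%:Z = t - n%:Z); last by lia.
by field; rewrite !qdenom.
Qed.

Lemma qbin_top t (n : nat) :
  qbin (t + 1) n * (1 - q ^ (t + 1 - n%:Z)) = qbin t n * (1 - q ^ (t + 1)).
Proof.
apply: (mulIf (invr_neq0 (qdenom n))).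
by have := qbin_absorb t n; rewrite qbinS !mulrA.
Qed.

Lemma expqD x y : q ^ (x + y) = q ^ x * q ^ y.
Proof. exact: expfzDr. Qed.

Lemma qbin_pascal t k :
  qbin (t + 1) k = qbin t k + q ^ (t + 1 - k) * qbin t (k - 1).
Proof.
case: k => [[|n]|n]; last by rewrite !qbin_neg ?mulr0 ?addr0 //; lia.
  by rewrite !qbin0 qbin_neg ?mulr0 ?addr0.
rewrite qbin_absorb qbinS (_ : n.+1%:Z - 1 = n); last by lia.
rewrite (_ : t + 1 - n.+1%:Z = t - n%:Z); last by lia.
rewrite (_ : t + 1 = t - n%:Z + n.+1%:Z); last by lia.
rewrite [q ^ (_ + n.+1%:Z)]expqD -exprnP.
by field; rewrite qdenom.
Qed.

Lemma qbin_pascal_sym t k :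
  qbin (t + 1) k = q ^ k * qbin t k + qbin t (k - 1).
Proof.
case: k => [[|n]|n]; last by rewrite !qbin_neg ?mulr0 ?addr0 //; lia.
  by rewrite !qbin0 qbin_neg ?addr0 ?expr0z ?mul1r.
rewrite qbin_absorb qbinS (_ : n.+1%:Z - 1 = n); last by lia.
rewrite (_ : t + 1 = t - n%:Z + n.+1%:Z); last by lia.
rewrite [q ^ (_ + n.+1%:Z)]expqD -exprnP.
by field; rewrite qdenom.
Qed.

Lemma qbin_sym (n : nat) k : qbin n k = qbin n (n%:Z - k).
Proof.
elim: n k => [|n IH] k.
  case: k => [[|k]|k]; first by rewrite subr0.
    by rewrite qbin_small // qbin_neg //; lia.
  by rewrite qbin_neg // qbin_small //; lia.
rewrite -addn1 PoszD qbin_pascal qbin_pascal_sym addrC IH [qbin n k]IH.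
by congr (_ * qbin _ _ + qbin _ _); lia.
Qed.

Lemma qbinnn (n : nat) : qbin n n = 1.
Proof. by rewrite qbin_sym subrr qbin0. Qed.

(** Both sides are a q-trinomial coefficient; if k or l is negative, both vanish. *)
Lemma qbin_mul t k l :
  qbin t k * qbin (t - k) l = qbin t (k + l) * qbin (k + l) k.
Proof.
case: (ltrP k 0) => [k0|].
  by rewrite !(qbin_neg _ k0) mul0r mulr0.
case: (ltrP l 0) => [l0|].
  move=> k0; rewrite (qbin_neg _ l0) mulr0.
  have [kl|kl] := ltrP (k + l) 0; first by rewrite qbin_neg ?mul0r.
  by rewrite [qbin (k + l) k]qbin_small ?mulr0 //; lia.
case: k l => [k|//] [l|//] _ _.
elim: l => [|l IH]; first by rewrite addr0 qbin0 qbinnn.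
rewrite -PoszD addnS !qbinS mulrA IH -PoszD.
have := qbin_top (k + l)%N k.
rewrite (_ : (k + l)%N%:Z + 1 = (k + l).+1%:Z); last by lia.
rewrite (_ : (k + l).+1%:Z - k%:Z = l.+1%:Z); last by lia.
rewrite (_ : t - k%:Z - l%:Z = t - (k + l)%N%:Z); last by lia.
rewrite -!exprnP => /(canRL (mulfK (qdenom l))) ->.
by field; rewrite !qdenom.
Qed.

Lemma qbin_factorial (t k : nat) : (k <= t)%N ->
  qbin t k * (\prod_(j < k) (1 - q ^+ j.+1) * \prod_(j < t - k) (1 - q ^+ j.+1))
  = \prod_(j < t) (1 - q ^+ j.+1).
Proof.
elim: k => [|k IH] kt; first by rewrite qbin0 subn0 big_ord0 !mul1r.
rewrite -IH; last exact: ltnW.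
have [m ->] : exists m, t = (k + m.+1)%N by exists (t - k.+1)%N; lia.
rewrite qbinS addKn addnS -addSn addKn !big_ord_recr /=.
rewrite (_ : (k.+1 + m)%N%:Z - k%:Z = m.+1%:Z); last by lia.
by rewrite -exprnP; field; rewrite qdenom.
Qed.

Lemma qvandermonde_step (M k : nat) (K m n : int) (f g : int -> F) :
  K + k%:Z <= M%:Z ->
  (forall j, f (j + 1) = g j) ->
  \sum_(u < M.+1) f (u%:Z - k%:Z) * qbin m (K - (u%:Z - k%:Z)) * qbin n (u%:Z - k%:Z - 1)
  = \sum_(u < M.+1) g (u%:Z - k%:Z) * qbin m (K - (u%:Z - k%:Z) - 1) * qbin n (u%:Z - k%:Z).
Proof.
move=> KM fg; rewrite big_ord_recl big_ord_recr /=.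
rewrite (@qbin_neg n); last by lia.
rewrite (@qbin_neg m (_ - 1)); last by lia.
rewrite !mulr0 mul0r addr0 add0r; apply: eq_bigr => i _.
rewrite -fg /bump /=; congr (f _ * qbin _ _ * qbin _ _); lia.
Qed.

(** The sum depends on m and n only through m + n: the two Pascal rules show that
it does not change when a unit moves from n to m, whatever their signs.  The
summation index is u - k because in [sears_expand1] and [sears_expand2] a
binomial [e - k; u - k] appears in a sum over u. *)
Lemma qvandermonde (M k : nat) (K m n : int) : K + k%:Z <= M%:Z ->
  \sum_(u < M.+1) q ^ ((u%:Z - k%:Z) * (m - K + (u%:Z - k%:Z)))
     * qbin m (K - (u%:Z - k%:Z)) * qbin n (u%:Z - k%:Z) = qbin (m + n) K.
Proof.
move=> KM; pose V m n := \sum_(u < M.+1) q ^ ((u%:Z - k%:Z) * (m - K + (u%:Z - k%:Z)))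
     * qbin m (K - (u%:Z - k%:Z)) * qbin n (u%:Z - k%:Z).
have V0 m' : V m' 0 = qbin m' K.
  have [kM|kM] := leqP k M; last first.
    rewrite [RHS]qbin_neg; last by lia.
    by apply: big1 => u _; rewrite (@qbin_neg 0) ?mulr0 //; have := ltn_ord u; lia.
  rewrite /V (bigD1 (Ordinal (kM : (k < M.+1)%N))) //= subrr mul0r expr0z qbin0 mul1r mulr1 subr0.
  rewrite big1 ?addr0 // => u; rewrite -val_eqE /= => uk.
  have [uk'|uk'] := ltnP u k; first by rewrite (@qbin_neg 0) ?mulr0 //; lia.
  by rewrite (@qbin_small 0) ?mulr0 //; lia.
have VS m' n' : V m' (n' + 1) = V (m' + 1) n'.
  rewrite /V.
  under eq_bigr => u _ do rewrite qbin_pascal_sym mulrDr.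
  under [RHS]eq_bigr => u _ do rewrite qbin_pascal mulrDr mulrDl.
  rewrite !big_split /=; congr (_ + _).
    apply: eq_bigr => u _; rewrite mulrA -[X in X * _ = _]mulrA [qbin _ _ * q ^ _]mulrC mulrA.
    by rewrite -expqD; congr (q ^ _ * _ * _); ring.
  rewrite (@qvandermonde_step _ _ _ _ _ (fun j => q ^ (j * (m' - K + j)))
    (fun j => q ^ ((j + 1) * (m' - K + (j + 1))))) //.
  by apply: eq_bigr => u _; rewrite mulrA -expqD; congr (q ^ _ * _ * _); ring.
suff VE n' m' : V m' n' = V (m' + n') 0 by rewrite -/(V m n) VE V0.
elim/int_ind: n' m' => [|n' IH|n' IH] m'; first by rewrite addr0.
  by rewrite (_ : n'.+1%:Z = n'%:Z + 1) ?VS ?IH; [congr (V _ _)|]; lia.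
have := VS (m' - 1) (- n'.+1%:Z).
rewrite subrK => <-; rewrite (_ : - n'.+1%:Z + 1 = - n'%:Z) ?IH; last by lia.
by congr (V _ _); lia.
Qed.

(** The same sum with the roles of m and n exchanged, which gives the second form
of the exponent. *)
Lemma qvandermonde_rev (M k : nat) (K m n : int) : K + k%:Z <= M%:Z ->
  \sum_(u < M.+1) q ^ ((K - (u%:Z - k%:Z)) * (n - (u%:Z - k%:Z)))
     * qbin m (K - (u%:Z - k%:Z)) * qbin n (u%:Z - k%:Z) = qbin (m + n) K.
Proof.
move=> KM; pose k' : nat := absz (M%:Z - K - k%:Z)%R.
have kE : k'%:Z = M%:Z - K - k%:Z by rewrite gez0_abs //; lia.
rewrite addrC -(@qvandermonde M k' K n m); last by lia.
rewrite [RHS](reindex_inj rev_ord_inj) /=; apply: eq_bigr => u _.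
rewrite subSS kE -subzn; last by rewrite -ltnS.
by rewrite mulrAC; congr (q ^ (_ * _) * qbin _ _ * qbin _ _); lia.
Qed.

Lemma sum_ord_trunc (a M : nat) (f : nat -> F) : (a <= M)%N ->
  (forall j, (a < j)%N -> f j = 0) -> \sum_(j < M.+1) f j = \sum_(j < a.+1) f j.
Proof.
move=> aM f0; rewrite -!(big_mkord xpredT f) (@big_cat_nat _ _ _ a.+1) //=.
rewrite [X in _ + X]big_nat_cond [X in _ + X]big1 ?addr0 // => j; rewrite andbT => /andP[aj _].
exact: f0.
Qed.

(** When n is a natural number the range need only reach n; the lower entry K can
be larger. *)
Lemma qvandermonde_nat (a n : nat) (m K : int) : (n <= a)%N ->
  \sum_(j < a.+1) q ^ (j%:Z * (m - K + j%:Z)) * qbin m (K - j%:Z) * qbin n j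
  = qbin (m + n%:Z) K.
Proof.
move=> na; rewrite -(@qvandermonde (a + absz K)%N 0) ?addr0; last by lia.
have f0 j : (a < j)%N -> q ^ (j%:Z * (m - K + j%:Z)) * qbin m (K - j%:Z) * qbin n j = 0.
  by move=> aj; rewrite (@qbin_small n) ?mulr0 //; lia.
rewrite -(sum_ord_trunc (leq_addr (absz K) a) f0).
by apply: eq_bigr => j _; rewrite subr0.
Qed.

Lemma qvandermonde_rev_nat (a n : nat) (m K : int) : (n <= a)%N ->
  \sum_(j < a.+1) q ^ ((K - j%:Z) * (n%:Z - j%:Z)) * qbin m (K - j%:Z) * qbin n j
  = qbin (m + n%:Z) K.
Proof.
move=> na; rewrite -(@qvandermonde_rev (a + absz K)%N 0) ?addr0; last by lia.
have f0 j : (a < j)%N -> q ^ ((K - j%:Z) * (n%:Z - j%:Z)) * qbin m (K - j%:Z) * qbin n j = 0.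
  by move=> aj; rewrite (@qbin_small n) ?mulr0 //; lia.
rewrite -(sum_ord_trunc (leq_addr (absz K) a) f0).
by apply: eq_bigr => j _; rewrite subr0.
Qed.

Variables (a : nat).

(** Up to normalization, a terminating balanced 4phi3 series in base q with
numerator parameters q^(s+1), q^-e, q^-a and q^(x-a-t). *)
Definition sears (x b s t e : int) : F :=
  \sum_(u < a.+1) q ^ (u%:Z ^+ 2 + u%:Z * (x - a%:Z - b)) * qbin (s + u%:Z) b * qbin e u
     * qbin (e + t + a%:Z - b - u%:Z) (a%:Z - u%:Z) * qbin t (x - a%:Z + u%:Z).

(** The part that the two expansions of [sears] share; it is invariant under the
substitution of [sears_symmetry] followed by the exchange of k and l. *)
Definition sears_coef (x b s t e : int) (k l : nat) : F :=
  qbin s (b - k%:Z) * qbin e k * qbin t (x - l%:Z) * qbin (e - b + x) l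
  * qbin (e + x - k%:Z - l%:Z) (a%:Z - k%:Z - l%:Z).

Lemma sears_prod1 (u k : nat) e :
  qbin e u * qbin u k = qbin e k * qbin (e - k%:Z) (u%:Z - k%:Z).
Proof. by rewrite qbin_mul addrC subrK. Qed.

Lemma sears_prod2 (u l : nat) x t :
  qbin (t - (x - a%:Z + u%:Z)) (a%:Z - u%:Z - l%:Z) * qbin t (x - a%:Z + u%:Z) =
  qbin t (x - l%:Z) * qbin (x - l%:Z) (a%:Z - l%:Z - u%:Z).
Proof.
rewrite mulrC qbin_mul.
rewrite (_ : x - a%:Z + u%:Z + (a%:Z - u%:Z - l%:Z) = x - l%:Z); last by ring.
case: (ltrP (x - l%:Z) 0) => [h|h]; first by rewrite qbin_neg // !mul0r.
congr (_ * _).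
rewrite -(gez0_abs h) qbin_sym gez0_abs //; congr (qbin _ _); ring.
Qed.

(** [s + u; b] is expanded into products [s; b - k][u; k], and the third
q-binomial, whose upper entry is t - (x - a + u) plus e - b + x, into products
with [e - b + x; l].  What remains of the sum over u is a q-Vandermonde sum; the
forms of the exponent in the two expansions are chosen to make it one. *)
Lemma sears_expand1 x b s t e : sears x b s t e = \sum_(k < a.+1) \sum_(l < a.+1)
   q ^ (k%:Z * (s - b + k%:Z) + (a%:Z - l%:Z) * (x - b - l%:Z)) * sears_coef x b s t e k l.
Proof.
transitivity (\sum_(u < a.+1) \sum_(k < a.+1) \sum_(l < a.+1)
  q ^ (k%:Z * (s - b + k%:Z) + (a%:Z - l%:Z) * (x - b - l%:Z)) *
  (qbin s (b - k%:Z) * qbin e k * qbin t (x - l%:Z) * qbin (e - b + x) l) *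
  (q ^ ((a%:Z - l%:Z - k%:Z - (u%:Z - k%:Z)) * (e - k%:Z - (u%:Z - k%:Z)))
     * qbin (x - l%:Z) (a%:Z - l%:Z - k%:Z - (u%:Z - k%:Z)) * qbin (e - k%:Z) (u%:Z - k%:Z))).
  apply: eq_bigr => u _.
  rewrite -(@qvandermonde_nat a u); last by rewrite -ltnS.
  rewrite (_ : e + t + a%:Z - b - u%:Z = t - (x - a%:Z + u%:Z) + (e - b + x)); last by ring.
  rewrite -(@qvandermonde_rev a 0); last by rewrite addr0; lia.
  rewrite mulr_sumr !mulr_suml [RHS]exchange_big; apply: eq_bigr => l _.
  rewrite mulr_sumr !mulr_suml; apply: eq_bigr => k _.
  rewrite !subr0.
  transitivity (q ^ (u%:Z ^+ 2 + u%:Z * (x - a%:Z - b)) * q ^ (k%:Z * (s - b + k%:Z))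
    * q ^ ((a%:Z - u%:Z - l%:Z) * (e - b + x - l%:Z)) * qbin s (b - k%:Z) * (qbin e u * qbin u k)
    * qbin (e - b + x) l * (qbin (t - (x - a%:Z + u%:Z)) (a%:Z - u%:Z - l%:Z) * qbin t (x - a%:Z + u%:Z))).
    ring.
  rewrite sears_prod1 sears_prod2.
  rewrite (_ : a%:Z - l%:Z - k%:Z - (u%:Z - k%:Z) = a%:Z - l%:Z - u%:Z); last by ring.
  rewrite (_ : e - k%:Z - (u%:Z - k%:Z) = e - u%:Z); last by ring.
  rewrite -!expqD.
  transitivity (q ^ (k%:Z * (s - b + k%:Z) + (a%:Z - l%:Z) * (x - b - l%:Z) + (a%:Z - l%:Z - u%:Z) * (e - u%:Z))
   * (qbin s (b - k%:Z) * qbin e k * qbin t (x - l%:Z) * qbin (e - b + x) l)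
   * qbin (x - l%:Z) (a%:Z - l%:Z - u%:Z) * qbin (e - k%:Z) (u%:Z - k%:Z)); last first.
    by rewrite expqD; ring.
  rewrite (_ : k%:Z * (s - b + k%:Z) + (a%:Z - l%:Z) * (x - b - l%:Z) + (a%:Z - l%:Z - u%:Z) * (e - u%:Z) = u%:Z ^+ 2 + u%:Z * (x - a%:Z - b) + k%:Z * (s - b + k%:Z) + (a%:Z - u%:Z - l%:Z) * (e - b + x - l%:Z)); last by ring.
  ring.
rewrite exchange_big; apply: eq_bigr => k _.
rewrite exchange_big; apply: eq_bigr => l _.
rewrite -mulr_sumr (@qvandermonde_rev a k); last by lia.
rewrite /sears_coef -[LHS]mulrA; congr (_ * (_ * qbin _ _)); ring.
Qed.

(** The expansions of [sears_expand1], each with the other form of the exponent in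
the q-Vandermonde sum: only the power of q differs. *)
Lemma sears_expand2 x b s t e : sears x b s t e = \sum_(k < a.+1) \sum_(l < a.+1)
   q ^ (k%:Z * (x - a%:Z - b + k%:Z) + l%:Z * (t - x + l%:Z)) * sears_coef x b s t e k l.
Proof.
transitivity (\sum_(u < a.+1) \sum_(k < a.+1) \sum_(l < a.+1)
  q ^ (k%:Z * (x - a%:Z - b + k%:Z) + l%:Z * (t - x + l%:Z)) *
  (qbin s (b - k%:Z) * qbin e k * qbin t (x - l%:Z) * qbin (e - b + x) l) *
  (q ^ ((u%:Z - k%:Z) * (x - l%:Z - (a%:Z - l%:Z - k%:Z) + (u%:Z - k%:Z)))
     * qbin (x - l%:Z) (a%:Z - l%:Z - k%:Z - (u%:Z - k%:Z)) * qbin (e - k%:Z) (u%:Z - k%:Z))).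
  apply: eq_bigr => u _.
  rewrite -(@qvandermonde_rev_nat a u); last by rewrite -ltnS.
  rewrite (_ : e + t + a%:Z - b - u%:Z = t - (x - a%:Z + u%:Z) + (e - b + x)); last by ring.
  rewrite -(@qvandermonde a 0); last by rewrite addr0; lia.
  rewrite mulr_sumr !mulr_suml [RHS]exchange_big; apply: eq_bigr => l _.
  rewrite mulr_sumr !mulr_suml; apply: eq_bigr => k _.
  rewrite !subr0.
  transitivity (q ^ (u%:Z ^+ 2 + u%:Z * (x - a%:Z - b)) * q ^ ((b - k%:Z) * (u%:Z - k%:Z))
    * q ^ (l%:Z * (t - (x - a%:Z + u%:Z) - (a%:Z - u%:Z) + l%:Z)) * qbin s (b - k%:Z) * (qbin e u * qbin u k)
    * qbin (e - b + x) l * (qbin (t - (x - a%:Z + u%:Z)) (a%:Z - u%:Z - l%:Z) * qbin t (x - a%:Z + u%:Z))).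
    ring.
  rewrite sears_prod1 sears_prod2.
  rewrite (_ : a%:Z - l%:Z - k%:Z - (u%:Z - k%:Z) = a%:Z - l%:Z - u%:Z); last by ring.
  rewrite -!expqD.
  transitivity (q ^ (k%:Z * (x - a%:Z - b + k%:Z) + l%:Z * (t - x + l%:Z) + (u%:Z - k%:Z) * (x - l%:Z - (a%:Z - l%:Z - k%:Z) + (u%:Z - k%:Z)))
   * (qbin s (b - k%:Z) * qbin e k * qbin t (x - l%:Z) * qbin (e - b + x) l)
   * qbin (x - l%:Z) (a%:Z - l%:Z - u%:Z) * qbin (e - k%:Z) (u%:Z - k%:Z)); last first.
    by rewrite expqD; ring.
  rewrite (_ : k%:Z * (x - a%:Z - b + k%:Z) + l%:Z * (t - x + l%:Z) + (u%:Z - k%:Z) * (x - l%:Z - (a%:Z - l%:Z - k%:Z) + (u%:Z - k%:Z)) = u%:Z ^+ 2 + u%:Z * (x - a%:Z - b) + (b - k%:Z) * (u%:Z - k%:Z) + l%:Z * (t - (x - a%:Z + u%:Z) - (a%:Z - u%:Z) + l%:Z)); last by ring.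
  ring.
rewrite exchange_big; apply: eq_bigr => k _.
rewrite exchange_big; apply: eq_bigr => l _.
rewrite -mulr_sumr (@qvandermonde a k); last by lia.
rewrite /sears_coef -[LHS]mulrA; congr (_ * (_ * qbin _ _)); ring.
Qed.

(** The first expansion of the left-hand side is term by term the second one of
the right-hand side. *)
Lemma sears_symmetry x b s t e :
  sears x b s t e = q ^ (a%:Z * (x - b)) * sears b x t s (e + x - b).
Proof.
rewrite sears_expand1 sears_expand2 [X in _ = _ * X]exchange_big mulr_sumr.
apply: eq_bigr => k _; rewrite mulr_sumr; apply: eq_bigr => l _.
rewrite [RHS]mulrA -expqD; congr (q ^ _ * _); first by ring.
rewrite /sears_coef (_ : e + x - b - x + b = e); last by ring.
rewrite (_ : e + x - b + b - l%:Z - k%:Z = e + x - k%:Z - l%:Z); last by ring.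
rewrite (_ : a%:Z - l%:Z - k%:Z = a%:Z - k%:Z - l%:Z); last by ring.
rewrite (_ : e + x - b = e - b + x); last by ring.
ring.
Qed.

End QBinomials.
Arguments qbin {F} q t k : simpl never.

(** * The identity for weighted paths *)

Section Paths.
Variables (F : fieldType) (q : F).
Hypothesis q_neq0 : q != 0.
Hypothesis q_not_root1 : forall n, q ^+ n.+1 != 1.
Local Notation qbin := (qbin q).
Variables (sg K : nat).

Definition halfz (z : int) : int := (z %/ 2)%Z.
Local Arguments halfz : simpl never.

(** Weight of a step d, which must have the parity of sg.  For sg = 0 or 1 the
exponent is (d^2 - sg) / 4, an integer; the summands sg / 4 are collected in
[vec_shift]. *)
Definition edge (d : int) : F :=
  if (2 %| d + sg%:Z)%Z then q ^ (d ^+ 2 %/ 4)%Z else 0.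

Lemma edgeN d : edge (- d) = edge d.
Proof.
rewrite /edge sqrrN; congr (if _ then _ else _); lia.
Qed.

(** Sum over the paths mu_0 = a, ..., mu_(k+1) = b with entries below K.  Each
entry carries the weight [(mu_(j-1) + mu_(j+1)) / 2; mu_j], the ends included:
al and be stand for mu_(-1) and mu_(k+2). *)
Fixpoint path_sum (k : nat) (al a b be : nat) : F :=
  if k is k'.+1 then
    \sum_(c < K) edge (a%:Z - c%:Z) * qbin (halfz (al + c)%N) a * path_sum k' a c b be
  else edge (a%:Z - b%:Z) * qbin (halfz (al + b)%N) a * qbin (halfz (a + be)%N) b.

(** Sum over the paths m_0 = w, m_1 = y, ..., m_(k+1) = 0; here the two ends carry
no weight. *)
Fixpoint descent_sum (k : nat) (w y : nat) : F :=
  if k is k'.+1 then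
    edge (w%:Z - y%:Z) * \sum_(z < K) qbin (halfz (w + z)%N) y * descent_sum k' y z
  else if y == 0%N then edge w else 0.

(** With al = 2 A + b, be = 2 B + a, w = 2 i + a - b and y = m_1, these are
[A + B + b - i; b - i], [A + m_1 / 2; i + a - b] and [B + m_1 / 2; i]. *)
Definition end_factor (al a b be w y : nat) : F :=
  if (2 %| w%:Z + a%:Z + b%:Z)%Z then
    qbin (halfz (al%:Z + be%:Z - w%:Z)) (halfz (a%:Z + b%:Z - w%:Z))
    * qbin (halfz (al%:Z - b%:Z + y%:Z)) (halfz (w%:Z + a%:Z - b%:Z))
    * qbin (halfz (be%:Z - a%:Z + y%:Z)) (halfz (w%:Z + b%:Z - a%:Z))
  else 0.

Definition descent_side (k : nat) (al a b be : nat) : F :=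
  \sum_(w < K) \sum_(y < K) descent_sum k w y * end_factor al a b be w y.

Lemma path_sumSr k al a b be : path_sum k.+1 al a b be =
  \sum_(d < K) edge (b%:Z - d%:Z) * qbin (halfz (d + be)%N) b * path_sum k al a d b.
Proof.
elim: k al a => [|k IH] al a.
  by apply: eq_bigr => c _ /=; rewrite -(edgeN (b%:Z - _)) opprB; ring.
rewrite [LHS]/=; under eq_bigr => c _ do rewrite -/(path_sum k.+1 a c b be) IH mulr_sumr.
rewrite exchange_big; apply: eq_bigr => d _ /=; rewrite mulr_sumr.
by apply: eq_bigr => c _; ring.
Qed.

Lemma path_sum_sym k al a b be : path_sum k al a b be = path_sum k be b a al.
Proof.
elim: k al a b be => [|k IH] al a b be.
  by rewrite /= -(edgeN (b%:Z - _)) opprB [(al + _)%N]addnC [(a + _)%N]addnC; ring.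
rewrite path_sumSr; apply: eq_bigr => d _.
by rewrite [(d + be)%N]addnC IH.
Qed.

Lemma descent_side_sym k al a b be : descent_side k al a b be = descent_side k be b a al.
Proof.
apply: eq_bigr => w _; apply: eq_bigr => y _; congr (_ * _).
rewrite /end_factor mulrAC -!addrA [b%:Z + a%:Z]addrC.
rewrite [al%:Z + (be%:Z - _)]addrCA [a%:Z + (b%:Z - _)]addrCA.
by congr (if _ then _ * _ * _ else _).
Qed.

(** A nonzero weight forces 2 mu_j <= mu_(j-1) + mu_(j+1), so paths are convex: one
that goes up from al to a cannot come back to b <= a. *)
Lemma path_sum_convex k al a b be :
  (al < a)%N -> (b <= a)%N -> path_sum k al a b be = 0.
Proof.
elim: k al a => [|k IH] al a ala ba /=.
  by rewrite [qbin (halfz (al + b)%N) a]qbin_small ?mulr0 ?mul0r // /halfz; lia.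
apply: big1 => c _; have [ca|ac] := leqP c a.
  by rewrite [qbin (halfz _) a]qbin_small ?mulr0 ?mul0r // /halfz; lia.
by rewrite IH ?mulr0 //; lia.
Qed.

(** A convex path that reaches 0 through nonnegative entries never goes up. *)
Lemma descent_sum_convex k w y : (w < y)%N -> descent_sum k w y = 0.
Proof.
elim: k w y => [|k IH] w y wy /=; first by case: eqP wy => // ->.
rewrite big1 ?mulr0 // => z _; have [zy|yz] := leqP z y.
  by rewrite [qbin (halfz _) y]qbin_small ?mulr0 ?mul0r // /halfz; lia.
by rewrite IH ?mulr0.
Qed.

Lemma descent_sum_parity k w y : ~~ (2 %| w%:Z + y%:Z + sg%:Z)%Z -> descent_sum k w y = 0.
Proof.
move=> par; case: k => [|k] /=.
  by case: eqP par => // ->; rewrite addr0 /edge => /negbTE ->.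
by rewrite /edge ifN ?mul0r //; move: par; apply: contra; lia.
Qed.

(** The hypothesis on G restricts c to |x - a| <= c <= x + a; in steps of two, this
range has the parametrization c = x - a + 2 u. *)
Lemma sum_clebsch_range (a x : nat) (G : int -> F) : (a + x < K)%N ->
  (forall c : int, c + a%:Z < x%:Z \/ x%:Z + a%:Z < c \/ x%:Z + c < a%:Z -> G c = 0) ->
  \sum_(c < K) (if (2 %| c%:Z + x%:Z + a%:Z)%Z then G c else 0)
  = \sum_(u < a.+1) G (2 * u%:Z + x%:Z - a%:Z).
Proof.
move=> axK G0.
transitivity (\sum_(c < K) \sum_(u < a.+1)
   (if c%:Z == 2 * u%:Z + x%:Z - a%:Z then G (2 * u%:Z + x%:Z - a%:Z) else 0)).
  apply: eq_bigr => c _; case: ifP => par; last first.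
    by rewrite big1 // => u _; case: eqP => // e; move: par; rewrite e => /negP []; lia.
  have [lo|lo] := ltrP (c%:Z + a%:Z) x%:Z.
    by rewrite G0 ?big1 //; [move=> u _; case: eqP => // e; rewrite G0 //|]; lia.
  have [hi|hi] := ltrP (x%:Z + a%:Z) c%:Z.
    by rewrite G0 ?big1 //; [move=> u _; case: eqP => // e; rewrite G0 //|]; lia.
  have hu : (absz (halfz (c%:Z + a%:Z - x%:Z)) < a.+1)%N by rewrite /halfz; lia.
  rewrite (bigD1 (Ordinal hu)) //= big1 ?addr0.
    have e : c%:Z = 2 * `|halfz (c%:Z + a%:Z - x%:Z)|%N%:Z + x%:Z - a%:Z.
      by rewrite /halfz; lia.
    by rewrite -e eqxx.
  move=> u; rewrite -val_eqE /= => /eqP ne; case: eqP => // e; case: ne.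
  by rewrite e /halfz; lia.
rewrite exchange_big; apply: eq_bigr => u _ /=.
have [neg|pos] := ltrP (2 * u%:Z + x%:Z - a%:Z) 0.
  rewrite G0; last by lia.
  by rewrite big1 // => c _; case: ifP.
have hc : (absz (2 * u%:Z + x%:Z - a%:Z)%R < K)%N by have := ltn_ord u; lia.
rewrite (bigD1 (Ordinal hc)) //= gez0_abs // eqxx big1 ?addr0 // => c.
by rewrite -val_eqE /= => /eqP ne; case: eqP => // e; case: ne; rewrite -e.
Qed.

Lemma sqr_div4 (d u : int) : ((d - 2 * u) ^+ 2 %/ 4)%Z = u ^+ 2 - u * d + (d ^+ 2 %/ 4)%Z.
Proof.
rewrite (_ : (d - 2 * u) ^+ 2 = (u ^+ 2 - u * d) * 4 + d ^+ 2); last by ring.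
by rewrite divzMDl.
Qed.

(** The step of the induction for a fixed descending path that starts with x, y: on
the left this path is preceded by the choice of the first step a, c of the
original path, on the right it is extended by a first entry w.  Both sums
vanish unless a + b + x has the parity of sg, and then the parametrizations
c = x - b + 2 u and w = a - b + 2 u turn them into the two sides of
[sears_symmetry]. *)
Lemma step_exchange (al a b be x y : nat) :
  (b + x < K)%N -> (a + b < K)%N ->
  (2 %| al%:Z + a%:Z + sg%:Z)%Z -> (2 %| be%:Z + b%:Z + sg%:Z)%Z ->
  (2 %| x%:Z + y%:Z + sg%:Z)%Z ->
  \sum_(c < K) edge (a%:Z - c%:Z) * qbin (halfz (al + c)%N) a * end_factor a c b be x y
  = \sum_(w < K) edge (w%:Z - x%:Z) * qbin (halfz (w + y)%N) x * end_factor al a b be w x.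
Proof.
move=> bxK abK pal pbe pxy.
pose G (c : int) := edge (a%:Z - c) * qbin (halfz (al%:Z + c)) a *
   (qbin (halfz (a%:Z + be%:Z - x%:Z)) (halfz (c + b%:Z - x%:Z))
    * qbin (halfz (a%:Z - b%:Z + y%:Z)) (halfz (x%:Z + c - b%:Z))
    * qbin (halfz (be%:Z - c + y%:Z)) (halfz (x%:Z + b%:Z - c))).
pose H (w : int) := edge (w - x%:Z) * qbin (halfz (w + y%:Z)) x *
   (qbin (halfz (al%:Z + be%:Z - w)) (halfz (a%:Z + b%:Z - w))
    * qbin (halfz (al%:Z - b%:Z + x%:Z)) (halfz (w + a%:Z - b%:Z))
    * qbin (halfz (be%:Z - a%:Z + x%:Z)) (halfz (w + b%:Z - a%:Z))).
transitivity (\sum_(c < K) (if (2 %| c%:Z + x%:Z + b%:Z)%Z then G c else 0)).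
  apply: eq_bigr => c _; rewrite /end_factor [x%:Z + c%:Z]addrC.
  by case: ifP => _; rewrite ?mulr0 // /G PoszD [x%:Z + c%:Z]addrC.
transitivity (\sum_(w < K) (if (2 %| w%:Z + a%:Z + b%:Z)%Z then H w else 0)); last first.
  apply: eq_bigr => c _; rewrite /end_factor.
  by case: ifP => _; rewrite ?mulr0.
have G0 (c : int) : c + b%:Z < x%:Z \/ x%:Z + b%:Z < c \/ x%:Z + c < b%:Z -> G c = 0.
  move=> h; rewrite /G; have [h1|[h1|h1]] : halfz (c + b%:Z - x%:Z) < 0 \/
     halfz (x%:Z + b%:Z - c) < 0 \/ halfz (x%:Z + c - b%:Z) < 0 by rewrite /halfz; lia.
  - by rewrite (qbin_neg _ _ h1) !(mul0r, mulr0).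
  - by rewrite (qbin_neg _ _ h1) !(mul0r, mulr0).
  - by rewrite (qbin_neg _ _ h1) !(mul0r, mulr0).
have H0 (w : int) : w + b%:Z < a%:Z \/ a%:Z + b%:Z < w \/ a%:Z + w < b%:Z -> H w = 0.
  move=> h; rewrite /H; have [h1|[h1|h1]] : halfz (w + b%:Z - a%:Z) < 0 \/
     halfz (a%:Z + b%:Z - w) < 0 \/ halfz (w + a%:Z - b%:Z) < 0 by rewrite /halfz; lia.
  - by rewrite (qbin_neg _ _ h1) !(mul0r, mulr0).
  - by rewrite (qbin_neg _ _ h1) !(mul0r, mulr0).
  - by rewrite (qbin_neg _ _ h1) !(mul0r, mulr0).
rewrite !sum_clebsch_range //; last by rewrite addnC.
have [pabx|pabx] := boolP (2 %| a%:Z + b%:Z + x%:Z + sg%:Z)%Z; last first.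
  rewrite !big1 // => u _.
    by rewrite /H /edge ifN ?mul0r //; move: pabx; apply: contra; lia.
  by rewrite /G /edge ifN ?mul0r //; move: pabx; apply: contra; lia.
pose s := halfz (al%:Z + x%:Z - b%:Z); pose e := halfz (a%:Z + be%:Z - x%:Z).
pose t := halfz (a%:Z - b%:Z + y%:Z).
transitivity (q ^ ((a%:Z + b%:Z - x%:Z) ^+ 2 %/ 4)%Z * sears q b x a s t e).
  rewrite mulr_sumr; apply: eq_bigr => u _; rewrite /G /edge ifT; last by lia.
  rewrite (_ : a%:Z - (2 * u%:Z + x%:Z - b%:Z) = a%:Z + b%:Z - x%:Z - 2 * u%:Z); last by ring.
  rewrite sqr_div4 addrC expfzDr //.
  rewrite (_ : halfz (al%:Z + _) = s + u%:Z); last by rewrite ?/s ?/e ?/t /halfz; lia.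
  rewrite (_ : halfz (2 * u%:Z + x%:Z - b%:Z + b%:Z - x%:Z) = u); last by rewrite ?/s ?/e ?/t /halfz; lia.
  rewrite (_ : halfz (x%:Z + (2 * u%:Z + x%:Z - b%:Z) - b%:Z) = x%:Z - b%:Z + u%:Z); last by rewrite ?/s ?/e ?/t /halfz; lia.
  rewrite (_ : halfz (be%:Z - _ + _) = e + t + b%:Z - a%:Z - u%:Z); last by rewrite ?/s ?/e ?/t /halfz; lia.
  rewrite (_ : halfz (x%:Z + b%:Z - _) = b%:Z - u%:Z); last by rewrite ?/s ?/e ?/t /halfz; lia.
  rewrite (_ : u%:Z ^+ 2 - _ = u%:Z ^+ 2 + u%:Z * (x%:Z - b%:Z - a%:Z)); last by ring.
  by rewrite -/e -/t; ring.
rewrite sears_symmetry // mulrA -expfzDr //.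
rewrite (_ : (_ %/ 4)%Z + _ = ((a%:Z - b%:Z - x%:Z) ^+ 2 %/ 4)%Z); last first.
  rewrite (_ : (a%:Z - b%:Z - x%:Z) ^+ 2 = b%:Z * (x%:Z - a%:Z) * 4 + (a%:Z + b%:Z - x%:Z) ^+ 2); last by ring.
  by rewrite divzMDl // addrC.
rewrite mulr_sumr; apply: eq_bigr => u _; rewrite /H /edge ifT; last by lia.
rewrite (_ : 2 * u%:Z + a%:Z - b%:Z - x%:Z = a%:Z - b%:Z - x%:Z - 2 * (- u%:Z)); last by ring.
rewrite sqr_div4 [q ^ (_ + (_ %/ 4)%Z)]expfzDr //.
rewrite (_ : halfz (2 * u%:Z + a%:Z - b%:Z + y%:Z) = t + u%:Z); last by rewrite ?/s ?/e ?/t /halfz; lia.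
rewrite (_ : halfz (2 * u%:Z + a%:Z - b%:Z + b%:Z - a%:Z) = u); last by rewrite ?/s ?/e ?/t /halfz; lia.
rewrite (_ : halfz (2 * u%:Z + a%:Z - b%:Z + a%:Z - b%:Z) = a%:Z - b%:Z + u%:Z); last by rewrite ?/s ?/e ?/t /halfz; lia.
rewrite (_ : halfz (al%:Z + be%:Z - _) = e + x%:Z - a%:Z + s + b%:Z - x%:Z - u%:Z); last by rewrite ?/s ?/e ?/t /halfz; lia.
rewrite (_ : halfz (a%:Z + b%:Z - _) = b%:Z - u%:Z); last by rewrite ?/s ?/e ?/t /halfz; lia.
rewrite (_ : halfz (be%:Z - a%:Z + x%:Z) = e + x%:Z - a%:Z); last by rewrite ?/s ?/e ?/t /halfz; lia.
rewrite (_ : halfz (al%:Z - b%:Z + x%:Z) = s); last by rewrite ?/s ?/e ?/t /halfz; lia.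
rewrite (_ : (- u%:Z) ^+ 2 - _ = u%:Z ^+ 2 + u%:Z * (a%:Z - b%:Z - x%:Z)); last by ring.
ring.
Qed.

(** The hypotheses b <= al and a <= be say that A and B are nonnegative.  If b <= a
they pass to the paths that start at c <= a, where (al, a, b, be) becomes
(a, c, b, be), and the paths that start with a step up contribute nothing to
either side; this is why the symmetry under reversal is used to arrange
b <= a. *)
Lemma path_sum_descent k al a b be : (2 * (a + b) < K)%N ->
  (b <= al)%N -> (a <= be)%N ->
  (2 %| al%:Z + a%:Z + sg%:Z)%Z -> (2 %| be%:Z + b%:Z + sg%:Z)%Z ->
  path_sum k al a b be = descent_side k al a b be.
Proof.
elim: k al a b be => [|k IH].
  move=> al a b be abK bal abe pal pbe.
  (* For x = 0 only c = b survives, and the two q-binomials containing y have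
     lower entry 0; the value y = sg only adjusts the parity. *)
  transitivity (\sum_(c < K) edge (a%:Z - c%:Z) * qbin (halfz (al + c)%N) a * end_factor a c b be 0 sg).
    have bK : (b < K)%N by lia.
    rewrite (bigD1 (Ordinal bK)) //= big1 ?addr0 => [|c].
      rewrite /end_factor ifT; last by lia.
      rewrite !add0r !subrr (_ : halfz 0 = 0) // !qbin0 !mulr1 !subr0.
      by rewrite (_ : halfz (b%:Z + b%:Z) = b); last by rewrite /halfz; lia.
    rewrite -val_eqE /= => cb; rewrite /end_factor; case: ifP => [par|_]; last by rewrite mulr0.
    have [cb'|bc] := ltnP c b.
      rewrite [qbin _ (halfz (0%:Z + c%:Z - b%:Z))]qbin_neg; last by rewrite /halfz; lia.
      by rewrite mulr0 mul0r mulr0.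
    rewrite [qbin _ (halfz (0%:Z + b%:Z - c%:Z))]qbin_neg; last by rewrite /halfz; lia.
    by rewrite !mulr0.
  rewrite step_exchange //; try lia.
  apply: eq_bigr => w _; have K0 : (0 < K)%N by lia.
  rewrite (bigD1 (Ordinal K0)) //= big1 ?addr0 => [|y]; first by rewrite qbin0 mulr1.
  by rewrite -val_eqE /= => /negbTE ->; rewrite mul0r.
have main al a b be : (2 * (a + b) < K)%N ->
  (b <= al)%N -> (a <= be)%N ->
  (2 %| al%:Z + a%:Z + sg%:Z)%Z -> (2 %| be%:Z + b%:Z + sg%:Z)%Z -> (b <= a)%N ->
  path_sum k.+1 al a b be = descent_side k.+1 al a b be.
  move=> abK bal abe pal pbe ba /=.
  transitivity (\sum_(c < K) edge (a%:Z - c%:Z) * qbin (halfz (al + c)%N) a * descent_side k a c b be).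
    apply: eq_bigr => c _.
    have [par|par] := boolP (2 %| a%:Z - c%:Z + sg%:Z)%Z; last by rewrite /edge ifN // !mul0r.
    have [ca|ac] := leqP c a.
      by rewrite IH //; lia.
    rewrite path_sum_convex //; last by lia.
    rewrite [descent_side _ _ _ _ _]big1 ?mulr0 // => w _; apply: big1 => y _.
    have [wy|yw] := ltnP w y; first by rewrite descent_sum_convex ?mul0r.
    rewrite /end_factor; case: ifP => [pwcb|_]; last by rewrite mulr0.
    rewrite [qbin (halfz (a%:Z - b%:Z + y%:Z)) _]qbin_small; last by rewrite /halfz; lia.
    by rewrite mulr0 mul0r mulr0.
  rewrite /descent_side; under eq_bigr => c _ do rewrite mulr_sumr.
  rewrite exchange_big.
  transitivity (\sum_(x < K) \sum_(y < K) descent_sum k x y *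
     \sum_(c < K) edge (a%:Z - c%:Z) * qbin (halfz (al + c)%N) a * end_factor a c b be x y).
    apply: eq_bigr => x _ /=; under eq_bigr => c _ do rewrite mulr_sumr.
    rewrite exchange_big; apply: eq_bigr => y _ /=; rewrite mulr_sumr.
    by apply: eq_bigr => c _; ring.
  transitivity (\sum_(x < K) \sum_(y < K) descent_sum k x y *
     \sum_(w < K) edge (w%:Z - x%:Z) * qbin (halfz (w + y)%N) x * end_factor al a b be w x).
    apply: eq_bigr => x _; apply: eq_bigr => y _.
    have [xy|yx] := ltnP x y; first by rewrite descent_sum_convex ?mul0r.
    have [pxy|pxy] := boolP (2 %| x%:Z + y%:Z + sg%:Z)%Z; last first.
      by rewrite descent_sum_parity ?mul0r.
    (* for x > a + b the bound K is too small to apply the exchange, but then all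
       the terms of both sums vanish *)
    have [xab|abx] := leqP x (a + b).
      by congr (_ * _); apply: step_exchange; lia.
    rewrite !big1 // => c _; rewrite /end_factor; case: ifP => // par; rewrite ?mulr0 //.
      have [cab|abc] := leqP c (a + b).
        rewrite [qbin (halfz (c + y)%N) x]qbin_small; last by rewrite /halfz; lia.
        by rewrite mulr0 mul0r.
      rewrite [qbin _ (halfz (a%:Z + b%:Z - c%:Z))]qbin_neg; last by rewrite /halfz; lia.
      by rewrite !mul0r mulr0.
    have [ca|ac] := leqP c a; last first.
      rewrite [qbin (halfz (a%:Z - b%:Z + y%:Z)) _]qbin_small; last by rewrite /halfz; lia.
      by rewrite mulr0 mul0r mulr0.
    rewrite [qbin _ (halfz (c%:Z + b%:Z - x%:Z))]qbin_neg; last by rewrite /halfz; lia.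
    by rewrite !mul0r mulr0.
  rewrite [RHS](eq_bigr (fun w : 'I_K => \sum_(x < K) \sum_(y < K) descent_sum k x y *
      (edge (w%:Z - x%:Z) * qbin (halfz (w + y)%N) x * end_factor al a b be w x))).
    rewrite [RHS]exchange_big; apply: eq_bigr => x _ /=; rewrite [RHS]exchange_big /=.
    by apply: eq_bigr => y _; rewrite mulr_sumr.
  move=> w _; apply: eq_bigr => x _ /=; rewrite mulr_sumr mulr_suml.
  by apply: eq_bigr => y _; ring.
move=> al a b be abK bal abe pal pbe; have [ba|/ltnW ab] := leqP b a; first exact: main.
by rewrite path_sum_sym descent_side_sym main // addnC.
Qed.

End Paths.
Arguments halfz : simpl never.

(** * Formal powers of q *)

Lemma qroot_neq0 : qroot != 0.
Proof. by rewrite /qroot tofrac_eq0 polyX_eq0. Qed.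

Lemma qroot_not_root1 n : qroot ^+ n.+1 != 1.
Proof.
rewrite /qroot -tofracXn -tofrac1 tofrac_eq; apply/eqP => /(congr1 (fun p : {poly rat} => size p)).
by rewrite size_polyXn size_poly1.
Qed.

Definition qbase (N : nat) : qfield := qroot ^+ N.

Lemma qbase_neq0 N : qbase N != 0.
Proof. by rewrite expf_neq0 ?qroot_neq0. Qed.

Lemma qbase_not_root1 N n : qbase N.+1 ^+ n.+1 != 1.
Proof. by rewrite -exprM mulSn addSn qroot_not_root1. Qed.

Lemma qpow_int (N : nat) (e : int) : qpow N e%:Q = qbase N ^ e.
Proof.
by rewrite /qpow -[N%:Q]/(N%:Z%:~R) -intrM numq_int -exprz_exp.
Qed.

Lemma qpowD (N : nat) (e f : rat) : N%:Q * e \is a Num.int -> N%:Q * f \is a Num.int ->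
  qpow N (e + f) = qpow N e * qpow N f.
Proof.
move=> /intrP[x xE] /intrP[y yE]; rewrite /qpow mulrDr xE yE -intrD !numq_int.
by rewrite expfzDr ?qroot_neq0.
Qed.

Lemma qpochE N n : qpoch N n = \prod_(j < n) (1 - qbase N ^+ j.+1).
Proof.
rewrite /qpoch big_add1 big_mkord; apply: eq_bigr => j _.
by rewrite qpow_int.
Qed.

Lemma qbinom_nat N (t k : nat) : qbinom N.+1 t%:Q k%:Q = qbin (qbase N.+1) t k.
Proof.
rewrite /qbinom; have [kt|tk] := leqP k t; last first.
  rewrite qbin_small ?ltz_nat //.
  case: ifP => // /andP[_ /natrP[n nE]].
  have : (t%:Q = k%:Q + n%:Q) by rewrite -[n%:Q]nE; ring.
  by move/eqP; rewrite -intrD eqr_int; lia.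
rewrite -intrB subzn // -!pmulrn !natr_nat /= !natrK.
have d n : qpoch N.+1 n != 0.
  rewrite qpochE; apply/prodf_neq0 => j _.
  by rewrite subr_eq0 eq_sym qbase_not_root1.
apply: (mulIf (mulf_neq0 (d k) (d (t - k)%N))); rewrite divfK ?mulf_neq0 //.
by rewrite !qpochE -(qbin_factorial (qbase_neq0 N.+1) (@qbase_not_root1 N) kt).
Qed.

(** * Vectors as paths: the Cartan matrix and the second difference *)

Lemma fsum_seq (T : choiceType) (R : zmodType) (A : set T) (r : seq T) (f : T -> R) :
  uniq r -> (forall i, i \in r -> A i) -> (forall i, A i -> f i != 0 -> i \in r) ->
  \sum_(i \in A) f i = \sum_(i <- r) f i.
Proof.
move=> ur rA Ar; rewrite (fsbigE r) //.
  rewrite big_seq_cond [RHS]big_seq; apply: eq_bigl => i.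
  by case: (boolP (i \in r)) => //= /rA; apply: mem_set.
by move=> i Ai; apply: contraNeq => /(Ar _ Ai).
Qed.

(** The path a, v_1, ..., v_n, b, constantly equal to b from there on. *)
Definition extend (n : nat) (a b : rat) (v : 'cV[rat]_n) (j : nat) : rat :=
  if j is j'.+1 then (if insub j' is Some i then v i 0 else b) else a.

Arguments extend : simpl never.

Lemma extend_ord n a b (v : 'cV[rat]_n) (i : 'I_n) : extend a b v i.+1 = v i 0.
Proof. by rewrite /extend valK. Qed.

Lemma extend_last n a b (v : 'cV[rat]_n) : extend a b v n.+1 = b.
Proof. by rewrite /extend insubF // ltnn. Qed.

Definition boundary (n : nat) (a b : rat) : 'cV[rat]_n :=
  a *: unitvec n 1 + b *: unitvec n n.

(** The equation that defines mu reads C mu = a e_1 + b e_n - 2 eta; moving the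
boundary terms into the extended path leaves its second difference. *)
Lemma mvec_extend n a b (eta : 'cV[int]_n) (v : 'cV[rat]_n) :
  (forall i : 'I_n, extend a b v i - 2 * extend a b v i.+1 + extend a b v i.+2
     = 2 * (eta i 0)%:~R) <-> v = mvec (boundary n a b) eta.
Proof.
pose f := extend a b v.
pose g j := if j == 0%N then 0 else if j == n.+1 then 0 else f j.
have CE (i : 'I_n) : (cartan n *m v) i 0 = 2 * f i.+1 - f i - f i.+2 + boundary n a b i 0.
  rewrite mxE (eq_bigr (fun j : 'I_n => cartan n i j * g j.+1)); last first.
    move=> j _; congr (_ * _); rewrite /g /= eqSS ltn_eqF ?ltn_ord //.
    by rewrite /f extend_ord.
  rewrite sum_cartan //; last by rewrite /g eqxx.
  rewrite !mxE /g /= !eqSS ltn_eqF //.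
  have -> : (if (i : nat) == 0%N then 0 else if (i : nat) == n.+1 then 0 else f i) = f i - a * (i == 0 :> nat)%:R.
    case: (eqVneq (i : nat) 0%N) => [->|i0]; first by rewrite mulr1 subrr.
    by rewrite ltn_eqF ?mulr0 ?subr0 // ltnW // ltnS.
  have -> : (if i.+1 == n then 0 else f i.+2) = f i.+2 - b * (i.+1 == n)%:R.
    case: eqP => [e|_]; last by rewrite mulr0 subr0.
    by rewrite e /f extend_last mulr1 subrr.
  ring.
have rE (i : 'I_n) : (2%:R^-1 *: (incidence n *m v + boundary n a b)) i 0
    = (2 * v i 0 - (cartan n *m v) i 0 + boundary n a b i 0) / 2.
  rewrite /incidence mulmxBl -scalemxAl mul1mx.
  by move: (cartan n *m v) (boundary n a b) => Cv B; rewrite !mxE; field.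
have lE (i : 'I_n) : (v + ratvec eta) i 0 = v i 0 + (eta i 0)%:~R by rewrite !mxE.
rewrite -mvecP -/(boundary n a b); split => h.
  by apply/colP => i; rewrite lE rE CE; have := h i; rewrite -/f /f extend_ord; lra.
by move=> i; have := congr1 (fun u : 'cV[rat]_n => u i 0) h; rewrite lE rE CE /f extend_ord; lra.
Qed.

Section QuadraticForm.
Variables (n : nat) (a b : rat) (eta : 'cV[int]_n) (v : 'cV[rat]_n).
Hypothesis vE : v = mvec (boundary n a b) eta.
Let f := extend a b v.

(* half the deviation of f from the affine function with the same end values *)
Let g (j : nat) : rat := (a + (b - a) * j%:R / n.+1%:R - f j) / 2.

Lemma deviation0 : g 0 = 0.
Proof. by rewrite /g /f /extend mulr0 mul0r addr0 subrr mul0r. Qed.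

Lemma deviation_last : g n.+1 = 0.
Proof.
rewrite /g /f extend_last mulfK ?pnatr_eq0 //; lra.
Qed.

(** The affine part of f is killed by second differences, so g has second
difference - eta and vanishes at both ends. *)
Lemma cartan_inv_vec : invmx (cartan n) *m ratvec eta = \col_i g i.+1.
Proof.
suff -> : ratvec eta = cartan n *m \col_i g i.+1 by rewrite mulKmx ?cartan_unitmx.
apply/colP => i; rewrite [RHS]mxE (eq_bigr (fun j : 'I_n => cartan n i j * g j.+1)); last first.
  by move=> j _; rewrite [X in _ * X]mxE.
rewrite sum_cartan ?deviation0 ?deviation_last // mxE.
have /mvec_extend/(_ i) := vE; rewrite -/f /g => h.
have -> : (eta i 0)%:~R = (f i - 2 * f i.+1 + f i.+2) / 2 by rewrite h; field.
by field; rewrite addrC natr1 pnatr_eq0.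
Qed.

Lemma cartan_inv_1E : cartan_inv_1 eta = (a + (b - a) / n.+1%:R - f 1) / 2.
Proof.
rewrite /cartan_inv_1 cartan_inv_vec /component.
transitivity (g 1); last by rewrite /g mulr1.
case: (posnP n) => [n0|n0]; last first.
  rewrite (bigD1 (Ordinal n0)) //= mxE big1 ?addr0 // => i /andP[/eqP[i0]].
  by rewrite -val_eqE /= i0.
rewrite big_pred0; first by have := deviation_last; rewrite n0.
by move=> i; have := leq_ltn_trans (leq0n i) (ltn_ord i); rewrite [X in (_ < X)%N]n0.
Qed.

Lemma sum_by_parts (h : nat -> rat) m : h 0 = 0 ->
  \sum_(j < m) (2 * h j.+1 - h j - h j.+2) * h j.+1
  = \sum_(j < m) (h j - h j.+1) ^+ 2 + h m * (h m - h m.+1).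
Proof.
move=> h0; elim: m => [|m IH]; first by rewrite !big_ord0 h0 mul0r addr0.
by rewrite !big_ord_recr /= IH; ring.
Qed.

(** By summation by parts the form is the sum of the squares of the steps of g; in
these, the cross terms with the constant slope telescope. *)
Lemma quadformE : quadform eta =
  (\sum_(j < n.+1) (f j - f j.+1) ^+ 2 - (a - b) ^+ 2 / n.+1%:R) / 4.
Proof.
rewrite /quadform -mulmxA cartan_inv_vec mxE.
transitivity (\sum_(j < n) (2 * g j.+1 - g j - g j.+2) * g j.+1).
  apply: eq_bigr => i _; rewrite !mxE; congr (_ * _).
  have /mvec_extend/(_ i) := vE; rewrite -/f /g => h.
  have -> : (eta i 0)%:~R = (f i - 2 * f i.+1 + f i.+2) / 2 by rewrite h; field.
  by field; rewrite addrC natr1 pnatr_eq0.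
rewrite (sum_by_parts _ deviation0) deviation_last subr0.
transitivity (\sum_(j < n.+1) (g j - g j.+1) ^+ 2).
  by rewrite [RHS]big_ord_recr /= deviation_last subr0.
transitivity (\sum_(j < n.+1) ((f j - f j.+1) ^+ 2 / 4 - (a - b) / n.+1%:R / 2 * (f j - f j.+1)
    + ((a - b) / n.+1%:R) ^+ 2 / 4)).
  by apply: eq_bigr => i _; rewrite /g; field; rewrite addrC natr1 pnatr_eq0.
rewrite big_split /= sumrB sumr_const card_ord -mulr_suml -mulr_sumr.
have -> : \sum_(j < n.+1) (f j - f j.+1) = a - b.
  rewrite -(big_mkord xpredT (fun j => f j - f j.+1)).
  rewrite (@telescope_sumr_eq _ 0 n.+1 (fun j => - f j)) //.
    by rewrite {1}/f extend_last opprK addrC.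
  by move=> k _; rewrite opprK addrC.
rewrite -mulr_natr; field; rewrite addrC natr1 pnatr_eq0 //.
Qed.

End QuadraticForm.

(** * Path sums as sums over tuples *)

Definition path_fun (a : nat) (s : seq nat) (b : nat) (j : nat) : nat :=
  nth 0%N (a :: rcons s b) j.

Lemma big_tuple_cons (R : nmodType) (T : finType) n (G : n.+1.-tuple T -> R) :
  \sum_(s : n.+1.-tuple T) G s = \sum_(c : T) \sum_(s : n.-tuple T) G (cons_tuple c s).
Proof.
rewrite pair_big (reindex (fun p : T * n.-tuple T => cons_tuple p.1 p.2)) //=.
exists (fun s => (thead s, behead_tuple s)) => [[c s] _|s _] /=.
  by congr (_, _); apply: val_inj.
by case/tupleP: s => x s; apply: val_inj; rewrite /= theadE.
Qed.

Section Chains.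
Variables (F : fieldType) (q : F) (sg K : nat).

Definition chain (n : nat) (f : nat -> nat) : F :=
  \prod_(j < n.+1) edge q sg ((f j)%:Z - (f j.+1)%:Z)
  * \prod_(j < n) qbin q (halfz (f j + f j.+2)%N) (f j.+1).

Lemma chainS n f : chain n.+1 f =
  edge q sg ((f 0%N)%:Z - (f 1%N)%:Z) * qbin q (halfz (f 0%N + f 2)%N) (f 1%N)
  * chain n (fun j => f j.+1).
Proof. by rewrite /chain big_ord_recl [X in _ * X]big_ord_recl /=; ring. Qed.

Lemma chain0 f : chain 0 f = edge q sg ((f 0%N)%:Z - (f 1%N)%:Z).
Proof. by rewrite /chain big_ord1 big_ord0 mulr1. Qed.

Let seqn n (s : n.-tuple 'I_K) : seq nat := map val s.

Lemma path_sumE n al a b be : path_sum q sg K n al a b be =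
  \sum_(s : n.-tuple 'I_K) chain n (path_fun a (seqn s) b)
    * qbin q (halfz (al + head b (seqn s))%N) a * qbin q (halfz (last a (seqn s) + be)%N) b.
Proof.
elim: n al a => [|n IH] al a.
  rewrite (bigD1 [tuple]) //= big1 ?addr0 => [|s]; last by move=> /eqP[]; exact: tuple0.
  by rewrite chain0.
rewrite big_tuple_cons /=; apply: eq_bigr => c _.
rewrite IH mulr_sumr; apply: eq_bigr => s _ /=.
rewrite chainS /= (_ : path_fun a _ b 2 = head b (seqn s)).
  by rewrite /path_fun /=; ring.
by rewrite /path_fun /seqn /=; case: s => -[].
Qed.

Lemma descent_sumE n w (phi : nat -> F) : (0 < K)%N ->
  \sum_(y < K) descent_sum q sg K n w y * phi y =
  \sum_(s : n.-tuple 'I_K) chain n (path_fun w (seqn s) 0) * phi (head 0%N (seqn s)).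
Proof.
move=> K0; elim: n w phi => [|n IH] w phi.
  rewrite [RHS](bigD1 [tuple]) //= [in RHS]big1 ?addr0 => [|s]; last by move=> /eqP[]; exact: tuple0.
  rewrite (bigD1 (Ordinal K0)) //= big1 ?addr0; first by rewrite chain0 /path_fun /= subr0.
  by move=> y; rewrite -val_eqE /= => /negbTE ->; rewrite mul0r.
rewrite big_tuple_cons /=; apply: eq_bigr => y _.
have := IH y (fun z => qbin q (halfz (w + z)%N) y).
rewrite mulr_sumr mulr_suml.
move=> /(congr1 (fun x => edge q sg (w%:Z - y%:Z) * phi y * x)).
rewrite !mulr_sumr => e; transitivity (\sum_(i < K) edge q sg (w%:Z - y%:Z) * phi y
  * (descent_sum q sg K n y i * qbin q (halfz (w + i)%N) y)).
  by apply: eq_bigr => z _; ring.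
rewrite e; apply: eq_bigr => s _ /=.
rewrite chainS /= (_ : path_fun w _ 0 2 = head 0%N (seqn s)).
  by rewrite /path_fun /=; ring.
by rewrite /path_fun /seqn /=; case: s => -[].
Qed.

End Chains.

(** * Sums over vectors as sums over paths *)

(** Once a convex sequence exceeds its initial value it never decreases again. *)
Lemma convex_bound (f : nat -> rat) n c :
  (forall i, (i < n)%N -> 0 <= f i - 2 * f i.+1 + f i.+2) ->
  f 0%N <= c -> f n.+1 <= c -> forall j, (j <= n.+1)%N -> f j <= c.
Proof.
move=> conv f0 fn.
have step j : (j <= n)%N -> f j <= f 0%N \/ f j <= f j.+1.
  elim: j => [|j IH] jn; first by left.
  have [le|gt] := lerP (f j.+1) (f 0%N); [by left | right].
  have := conv j jn; have [|] := IH (ltnW jn); lra.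
move=> j jn; rewrite -(subKn jn); move: (n.+1 - j)%N (leq_subr j n.+1) => k.
elim: k => [|k IH] kn; first by rewrite subn0.
have jle : (n.+1 - k.+1 <= n)%N by rewrite subSS leq_subr.
case: (step _ jle) => h; first exact: le_trans h f0.
by apply: le_trans h _; rewrite -subSn // subSS; apply: IH; apply: ltnW.
Qed.

Section VectorSums.
Variables (n sg K a b : nat).
Let N := n.+1.
Let q := qbase N.
Hypothesis sg01 : (sg <= 1)%N.
Hypotheses (aK : (a < K)%N) (bK : (b < K)%N).
Hypothesis par : (2 %| a%:Z - b%:Z + sg%:Z * N%:Z)%Z.

Let pf (s : n.-tuple 'I_K) : nat -> nat := path_fun a (map val s) b.

Definition tuple_vec (s : n.-tuple 'I_K) : 'cV[rat]_n := \col_i (nat_of_ord (tnth s i))%:Q.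

Definition second_diff (f : nat -> nat) : 'cV[int]_n :=
  \col_i halfz ((f i)%:Z - 2 * (f i.+1)%:Z + (f i.+2)%:Z).

Definition parity_steps (f : nat -> nat) : bool :=
  [forall j : 'I_n.+1, (2 %| (f j)%:Z - (f j.+1)%:Z + sg%:Z)%Z].

Lemma extend_path s j : (j <= n.+1)%N ->
  extend a%:Q b%:Q (tuple_vec s) j = (pf s j)%:Q.
Proof.
case: j => [|j] //; rewrite ltnS leq_eqVlt /pf /path_fun /= => /orP[/eqP->|jn].
  by rewrite extend_last nth_rcons size_map size_tuple ltnn eqxx.
rewrite (extend_ord _ _ _ (Ordinal jn)) mxE nth_rcons size_map size_tuple jn.
rewrite (nth_map (tnth s (Ordinal jn))) ?size_tuple //.
by rewrite [in LHS](tnth_nth (tnth s (Ordinal jn))).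
Qed.

Lemma second_diffE s : parity_steps (pf s) ->
  tuple_vec s = mvec (boundary n a%:Q b%:Q) (second_diff (pf s)).
Proof.
move=> /forallP alt; apply/mvec_extend => i.
have il := ltn_ord i.
rewrite !extend_path; try lia.
rewrite mxE (_ : 2 = 2%:~R :> rat) // -!(intrM, intrB, intrD); congr (_%:~R).
have := alt (widen_ord (leqnSn n) i); have := alt (lift ord0 i); rewrite /= /bump /= add1n.
by rewrite /halfz; lia.
Qed.

Lemma chain_eq0 s : ~~ parity_steps (pf s) -> chain q sg n (pf s) = 0.
Proof.
rewrite negb_forall => /existsP[j /negbTE h].
by rewrite /chain (bigD1 j) //= /edge h !mul0r.
Qed.

(** The part of eta C^-1 eta that depends on the end points only: the rest is the
sum of the exponents in the weights [edge] of the steps. *)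
Definition vec_shift : rat := ((sg * N)%N%:Q - (a%:Q - b%:Q) ^+ 2 / N%:Q) / 4.

(** With a - b + sg N = 2 k and sg^2 = sg, the value is k (sg N - k). *)
Lemma int_vec_shift : N%:Q * vec_shift \is a Num.int.
Proof.
rewrite /vec_shift.
have -> : N%:Q * (((sg * N)%N%:Q - (a%:Q - b%:Q) ^+ 2 / N%:Q) / 4)
   = ((sg%:Z * N%:Z ^+ 2 - (a%:Z - b%:Z) ^+ 2) %/ 4)%Z%:Q.
  have -> : N%:Q * (((sg * N)%N%:Q - (a%:Q - b%:Q) ^+ 2 / N%:Q) / 4)
    = (sg%:Z * N%:Z ^+ 2 - (a%:Z - b%:Z) ^+ 2)%:Q / 4.
    rewrite PoszM !(intrB, intrM, rmorphXn) /=; field.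
    by rewrite ?[1 + _]addrC ?natr1 pnatr_eq0.
  have d4 : (4 %| sg%:Z * N%:Z ^+ 2 - (a%:Z - b%:Z) ^+ 2)%Z.
    have [k kE] : exists k, a%:Z - b%:Z + sg%:Z * N%:Z = 2 * k.
      by exists (halfz (a%:Z - b%:Z + sg%:Z * N%:Z)); rewrite /halfz; lia.
    have s2 : sg%:Z ^+ 2 = sg%:Z by case: sg sg01 => [|[|]].
    apply/dvdzP; exists (k * (sg%:Z * N%:Z - k)).
    rewrite -{1}s2 -exprMn (_ : a%:Z - b%:Z = 2 * k - sg%:Z * N%:Z); last by rewrite -kE; ring.
    ring.
  by rewrite -{1}(divzK d4) intrM mulfK.
exact: intr_int.
Qed.

Lemma qpow_quadform s : parity_steps (pf s) ->
  qpow N (quadform (second_diff (pf s)))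
  = qpow N vec_shift * \prod_(j < n.+1) edge q sg ((pf s j)%:Z - (pf s j.+1)%:Z).
Proof.
move=> alt; have /second_diffE/quadformE -> := alt.
pose d (j : nat) : int := ((pf s j)%:Z - (pf s j.+1)%:Z) ^+ 2.
have dE (j : 'I_n.+1) : d j = 4 * (d j %/ 4)%Z + sg%:Z.
  have /forallP/(_ j) := alt; rewrite /d; move: ((pf s j)%:Z - _) => x.
  have [k [kE|kE]] : exists k, x = 2 * k \/ x = 2 * k + 1.
    by exists (halfz x); rewrite /halfz; lia.
    move=> h; have -> : sg = 0%N by move: h sg01; rewrite kE; lia.
    rewrite kE (_ : (2 * k) ^+ 2 = k ^+ 2 * 4); last by ring.
    by rewrite mulzK // mulrC addr0.
  move=> h; have -> : sg = 1%N by move: h sg01; rewrite kE; lia.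
  rewrite kE (_ : (2 * k + 1) ^+ 2 = (k ^+ 2 + k) * 4 + 1); last by ring.
  by rewrite divzMDl // addr0 mulrC.
have -> : (\sum_(j < n.+1)
   (extend a%:Q b%:Q (tuple_vec s) j - extend a%:Q b%:Q (tuple_vec s) j.+1) ^+ 2
     - (a%:Q - b%:Q) ^+ 2 / n.+1%:R) / 4
   = vec_shift + (\sum_(j < n.+1) (d j %/ 4)%Z)%:Q.
  have -> : \sum_(j < n.+1)
   (extend a%:Q b%:Q (tuple_vec s) j - extend a%:Q b%:Q (tuple_vec s) j.+1) ^+ 2
    = (\sum_(j < n.+1) (4 * (d j %/ 4)%Z + sg%:Z))%:Q.
    rewrite (raddf_sum intr) /=; apply: eq_bigr => j _.
    by rewrite -dE (extend_path s (ltnW (ltn_ord j))) (extend_path s (ltn_ord j)) /d rmorphXn rmorphB.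
  rewrite big_split /= -mulr_sumr sumr_const card_ord -[sg%:Z *+ _]mulr_natr (natz n.+1).
  move: (\sum_(i < _) _) => S; rewrite !(intrD, intrM) /vec_shift PoszM intrM.
  rewrite -/N; by field; rewrite ?[1 + _]addrC ?natr1 pnatr_eq0.
rewrite qpowD ?int_vec_shift //; last by rewrite rpredM ?intr_int.
congr (_ * _); rewrite qpow_int.
have -> : \prod_(j < n.+1) edge q sg ((pf s j)%:Z - (pf s j.+1)%:Z)
  = \prod_(j < n.+1) q ^ (d j %/ 4)%Z.
  by apply: eq_bigr => j _; rewrite /edge; have /forallP/(_ j) -> := alt.
elim: (n.+1) => [|m IH]; first by rewrite !big_ord0.
by rewrite !big_ord_recr /= expfzDr ?qbase_neq0 // IH.
Qed.

(** [eta_j + mu_j; eta_j] = [eta_j + mu_j; mu_j], and eta_j + mu_j is the mean of the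
neighbours of mu_j.  If eta_j is negative, both sides vanish. *)
Lemma qbinom_vec_path s : parity_steps (pf s) ->
  qbinom_vec N (ratvec (second_diff (pf s)) + tuple_vec s) (ratvec (second_diff (pf s)))
  = \prod_(j < n) qbin q (halfz (pf s j + pf s j.+2)%N) (pf s j.+1).
Proof.
move=> /forallP alt; apply: eq_bigr => i _; have il := ltn_ord i.
have h1 := alt (widen_ord (leqnSn n) i); have := alt (lift ord0 i).
rewrite /= /bump /= add1n in h1 * => h2.
have tv : tuple_vec s i 0 = (pf s i.+1)%:Q.
  by rewrite -(extend_ord a%:Q b%:Q) extend_path // ltnW.
have rv : ratvec (second_diff (pf s)) i 0 =
    (halfz ((pf s i)%:Z - 2 * (pf s i.+1)%:Z + (pf s i.+2)%:Z))%:Q by rewrite !mxE.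
move: (ratvec _) rv => w rv; rewrite [X in qbinom N X]mxE tv rv.
set e := halfz (_ - _ + _); set x := pf s i.+1.
have eE : e + x%:Z = halfz (pf s i + pf s i.+2)%N by rewrite /e /x /halfz; lia.
rewrite -intrD -eE; have [e0|e0] := lerP 0 e; last first.
  rewrite qbin_small; last by rewrite eE /halfz; move: e0; rewrite /e /x /halfz; lia.
  rewrite /qbinom; case: ifP => // /andP[/natr_ge0].
  by rewrite ler0z leNgt e0.
rewrite -(gez0_abs e0) -PoszD qbinom_nat qbin_sym ?qbase_neq0 //; last exact: qbase_not_root1.
by congr (qbin _ _ _); rewrite PoszD; ring.
Qed.

(** The q-binomials force eta and mu to be vectors of natural numbers, so that the
path is convex and bounded by a and b.  The congruence gives the parity of the
first step, and the second differences 2 eta propagate it to all the steps. *)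
Lemma mvec_pathP (eta : 'cV[int]_n) :
  let v := mvec (boundary n a%:Q b%:Q) eta in
  (a%:Z - b%:Z + sg%:Z * N%:Z)%:Q / (2 * N)%N%:Q + cartan_inv_1 eta \is a Num.int ->
  qbinom_vec N (ratvec eta + v) (ratvec eta) != 0 ->
  exists2 s, parity_steps (pf s) & eta = second_diff (pf s).
Proof.
move=> v cond /prodf_neq0 nz.
have vE : v = mvec (boundary n a%:Q b%:Q) eta by [].
have natE i : (0 <= eta i 0) /\ exists m : nat, v i 0 = m%:Q.
  have := nz i isT; rewrite !mxE /qbinom; case: ifP; last by rewrite eqxx.
  move=> /andP[/natr_ge0]; rewrite ler0z => -> /natrP[m mE] _; split=> //.
  by exists m; rewrite -pmulrn -mE; ring.
have rec := (mvec_extend a%:Q b%:Q eta v).2 vE.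
have bound j : (j <= n.+1)%N -> extend a%:Q b%:Q v j <= (maxn a b)%:Q.
  apply: convex_bound => //.
  - move=> i il; rewrite (rec (Ordinal il)).
    by have [h _] := natE (Ordinal il); rewrite mulr_ge0 ?ler0z.
  - by rewrite ler_int lez_nat leq_maxl.
  - by rewrite extend_last ler_int lez_nat leq_maxr.
pose m i := Num.truncn (v i 0).
have mE i : v i 0 = (m i)%:Q.
  by have [_ [k kE]] := natE i; rewrite /m kE -pmulrn natrK.
have mK i : (m i < K)%N.
  have := bound i.+1 (ltnW (ltn_ord i)); rewrite extend_ord mE ler_int lez_nat => h.
  by apply: leq_ltn_trans h _; rewrite gtn_max aK bK.
pose s := [tuple Ordinal (mK i) | i < n].
have vs : v = tuple_vec s by apply/colP => i; rewrite mE [RHS]mxE tnth_mktuple.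
have recs (i : 'I_n) : (pf s i)%:Z - 2 * (pf s i.+1)%:Z + (pf s i.+2)%:Z = 2 * eta i 0.
  have il := ltn_ord i; have := rec i; rewrite vs !extend_path; try lia.
  by rewrite (_ : 2 = 2%:~R :> rat) // -!(intrM, intrB, intrD) => /intr_inj.
exists s; last first.
  by apply/colP => i; rewrite mxE recs /halfz mulrC mulzK.
have alt0 : (2 %| a%:Z - (pf s 1%N)%:Z + sg%:Z)%Z.
  have := cond; rewrite (cartan_inv_1E vE) vs extend_path //.
  have -> : (a%:Z - b%:Z + sg%:Z * N%:Z)%:Q / (2 * N)%N%:Q
     + (a%:Q + (b%:Q - a%:Q) / n.+1%:R - (pf s 1%N)%:Q) / 2
     = (a%:Z - (pf s 1%N)%:Z + sg%:Z)%:Q / 2.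
    rewrite PoszM !(intrD, intrB, intrM).
    rewrite -/N; by field; rewrite ?[1 + _]addrC ?natr1 pnatr_eq0.
  move=> /intrP[k kE]; apply/dvdzP; exists k; apply: (@intr_inj rat).
  by rewrite intrM -kE divfK.
apply/forallP => -[j jn] /=; elim: j jn => [//|j IH] jn.
have := IH (ltnW jn); have := recs (Ordinal (jn : (j < n)%N)); rewrite /=; lia.
Qed.

Lemma path_cond s : parity_steps (pf s) ->
  (a%:Z - b%:Z + sg%:Z * N%:Z)%:Q / (2 * N)%N%:Q + cartan_inv_1 (second_diff (pf s))
    \is a Num.int.
Proof.
move=> alt; rewrite (cartan_inv_1E (second_diffE alt)) extend_path //.
have -> : (a%:Z - b%:Z + sg%:Z * N%:Z)%:Q / (2 * N)%N%:Q
     + (a%:Q + (b%:Q - a%:Q) / n.+1%:R - (pf s 1%N)%:Q) / 2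
     = (halfz (a%:Z - (pf s 1%N)%:Z + sg%:Z))%:Q.
  have h : 2 * halfz (a%:Z - (pf s 1%N)%:Z + sg%:Z) = a%:Z - (pf s 1%N)%:Z + sg%:Z.
    by have /forallP/(_ ord0) := alt; rewrite /halfz /=; lia.
  have -> : (halfz (a%:Z - (pf s 1%N)%:Z + sg%:Z))%:Q = (a%:Z - (pf s 1%N)%:Z + sg%:Z)%:Q / 2.
    by rewrite -[in RHS]h intrM [2%:~R * _]mulrC mulfK.
  rewrite PoszM !(intrD, intrB, intrM).
  rewrite -/N; by field; rewrite ?[1 + _]addrC ?natr1 pnatr_eq0.
exact: intr_int.
Qed.

Lemma vector_sum_path (Phi : 'cV[rat]_n -> qfield) :
  \sum_(eta \in [set eta : 'cV[int]_n |
      (a%:Z - b%:Z + sg%:Z * N%:Z)%:Q / (2 * N)%N%:Q + cartan_inv_1 eta \is a Num.int])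
    (let mu := mvec (boundary n a%:Q b%:Q) eta in
     qpow N (quadform eta) * qbinom_vec N (ratvec eta + mu) (ratvec eta) * Phi mu)
  = qpow N vec_shift
    * \sum_(s : n.-tuple 'I_K) chain q sg n (pf s) * Phi (tuple_vec s).
Proof.
pose r := [seq second_diff (pf s) | s <- enum [pred s | parity_steps (pf s)]].
rewrite (fsum_seq (r := r)) /=; first last.
- move=> eta /= cond; rewrite mulf_eq0 negb_or mulf_eq0 negb_or => /andP[/andP[_ nz] _].
  have [s alt ->] := mvec_pathP cond nz.
  by apply: map_f; rewrite mem_enum.
- by move=> eta /mapP[s]; rewrite mem_enum => /path_cond alt ->.
- rewrite map_inj_in_uniq ?enum_uniq // => s t; rewrite !mem_enum => sa ta e.
  have : tuple_vec s = tuple_vec t by rewrite (second_diffE sa) (second_diffE ta) e.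
  move=> /colP st; apply: eq_from_tnth => i; have := st i; rewrite !mxE.
  by move/intr_inj => [] /val_inj.
rewrite big_map big_enum /= mulr_sumr [RHS](bigID (fun s => parity_steps (pf s))) /=.
rewrite [X in _ = _ + X]big1 ?addr0; last first.
  by move=> s /chain_eq0 ->; rewrite mul0r mulr0.
apply: eq_bigr => s; rewrite inE => alt.
rewrite -(second_diffE alt) (qpow_quadform alt) (qbinom_vec_path alt) /chain.
by rewrite !mulrA.
Qed.

End VectorSums.

(** * Where the two sides can be nonzero *)

Lemma qbinom_neq0 N (t k : rat) : qbinom N t k != 0 -> 0 <= k /\ k <= t.
Proof.
rewrite /qbinom; case: ifP; last by rewrite eqxx.
by move=> /andP[/natr_ge0 ? /natr_ge0]; rewrite subr_ge0.
Qed.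

Lemma mul4_neq0 (R : idomainType) (x y z w : R) :
  x * y * (z * w) != 0 -> [/\ y != 0, z != 0 & w != 0].
Proof. by rewrite !mulf_eq0 !negb_or => /andP[/andP[_ ->] /andP[-> ->]]. Qed.

Lemma component_extend n a b (v : 'cV[rat]_n) j : (j < n)%N ->
  component v j.+1 = extend a b v j.+1.
Proof.
move=> jn; rewrite /component (bigD1 (Ordinal jn)) //= big1 ?addr0.
  by rewrite (extend_ord _ _ _ (Ordinal jn)).
by move=> i /andP[/eqP[e]]; rewrite -val_eqE /= e eqxx.
Qed.

Lemma component0 (v : 'cV[rat]_0) j : component v j = 0.
Proof. by rewrite /component big1 // => -[]. Qed.

Lemma convex_slopes (f : nat -> rat) n :
  (forall i, (i < n)%N -> 0 <= f i - 2 * f i.+1 + f i.+2) ->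
  f 1%N - f 0%N <= (f n.+1 - f 0%N) / n.+1%:R <= f n.+1 - f n.
Proof.
move=> conv; have n0 : 0 < n.+1%:R :> rat by rewrite ltr0n.
suff [h1 h2] : (f 1%N - f 0%N) * n.+1%:R <= f n.+1 - f 0%N
   /\ f n.+1 - f 0%N <= (f n.+1 - f n) * n.+1%:R.
  by rewrite ler_pdivlMr // ler_pdivrMr // h1.
have {}conv i : (i < n)%N -> f i.+1 - f i <= f i.+2 - f i.+1.
  by move/conv; lra.
suff H m : (m <= n)%N -> [/\ (f 1%N - f 0%N) * m.+1%:R <= f m.+1 - f 0%N,
   f m.+1 - f 0%N <= (f m.+1 - f m) * m.+1%:R & f 1%N - f 0%N <= f m.+1 - f m].
  by have [] := H n (leqnn n).
elim: m => [|m IH] mn; first by rewrite !mulr1.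
have [h1 h2 h3] := IH (ltnW mn); have h4 := conv m mn.
have m0 : 0 <= m.+1%:R :> rat by [].
have h5 := ler_wpM2r m0 h4.
by rewrite -[m.+2%:R]natr1; split; lra.
Qed.

(** Nonzero q-binomials make the path convex, so that its mean slope lies between
the first and the last step. *)
Lemma mvec_slopes N n a b (eta : 'cV[int]_n) :
  let mu := mvec (boundary n a b) eta in
  qbinom_vec N (ratvec eta + mu) (ratvec eta) != 0 ->
  let f := extend a b mu in f 1%N - a <= (b - a) / n.+1%:R <= b - f n.
Proof.
move=> mu /prodf_neq0 nz; have rec := (mvec_extend a b eta mu).2 (erefl _).
have := @convex_slopes (extend a b mu) n; rewrite extend_last; apply.
move=> i il; rewrite (rec (Ordinal il)) mulr_ge0 //.
have := nz (Ordinal il) isT; rewrite !mxE => /qbinom_neq0[h _].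
exact: h.
Qed.

(** For N = 1 the extended path is a, b, so that its entries 1 and N - 1 are b and a,
the values at which mu_1 and mu_(N-1) are read in that case. *)
Lemma Xinner_extend n (sigma a b : int) (t1 t2 : rat) :
  Xinner n.+1 sigma a b t1 t2 =
  \sum_(eta \in [set eta : 'cV[int]_n |
      (a - b + sigma * n.+1%:Z)%:Q / (2 * n.+1)%:Q + cartan_inv_1 eta \is a Num.int])
    (let mu := mvec (boundary n a%:Q b%:Q) eta in
     qpow n.+1 (quadform eta) * qbinom_vec n.+1 (ratvec eta + mu) (ratvec eta)
     * (qbinom n.+1 (t1 - (b%:Q - extend a%:Q b%:Q mu 1) / 2) a%:Q
        * qbinom n.+1 (t2 - (a%:Q - extend a%:Q b%:Q mu n) / 2) b%:Q)).
Proof.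
rewrite /Xinner /=; apply: eq_fsbigr => eta _; rewrite -/(boundary n a%:Q b%:Q) -[LHS]mulrA.
move: (mvec _ _) => mu.
have -> : (if n.+1 == 1%N then b%:Q else component mu 1) = extend a%:Q b%:Q mu 1.
  case: n eta mu => [|n] eta mu /=; first by rewrite /extend insubF.
  by rewrite (component_extend a%:Q b%:Q).
have -> // : (if n.+1 == 1%N then a%:Q else component mu n) = extend a%:Q b%:Q mu n.
case: n eta mu => [|n] eta mu //=.
by rewrite (component_extend a%:Q b%:Q).
Qed.

(** The condition a <= A + (b + mu_1) / 2 bounds mu_1 from below, and convexity
bounds it from above by a + (b - a) / N; likewise for mu_(N-1). *)
Lemma Xinner_neq0 n (sigma a b : int) (A B : rat) :
  Xinner n.+1 sigma a b (A + b%:Q) (B + a%:Q) != 0 ->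
  [/\ 0 <= a, 0 <= b, 0 <= A + (b - a)%:Q * (n.+2%:R / (2 * n.+1)%:R)
    & 0 <= B + (a - b)%:Q * (n.+2%:R / (2 * n.+1)%:R)].
Proof.
rewrite Xinner_extend; apply: contraNP => h; apply/eqP/fsbig1 => eta _ /=.
set mu := mvec _ _; apply/eqP; apply: contra_notT h.
move=> /mul4_neq0[/mvec_slopes].
rewrite -/mu /=; move: (extend _ _ _ 1) (extend _ _ _ n) => f1 fn /andP[h1 h2].
move=> /qbinom_neq0[a0 h3] /qbinom_neq0[b0 h4].
rewrite ler0z in a0; rewrite ler0z in b0; split=> //.
  rewrite intrB natrM.
  have -> : A + (b%:Q - a%:Q) * (n.+2%:R / (2 * n.+1%:R)) =
    A + b%:Q - a%:Q - (b%:Q - a%:Q - (b%:Q - a%:Q) / n.+1%:R) / 2.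
    by rewrite -[n.+2%:R]natr1; field; rewrite ?[1 + _]addrC ?natr1 pnatr_eq0.
  by move: (_ / n.+1%:R) h1 h2 => X h1 h2; lra.
rewrite intrB natrM.
have -> : B + (a%:Q - b%:Q) * (n.+2%:R / (2 * n.+1%:R)) =
    B + a%:Q - b%:Q - (a%:Q - b%:Q + (b%:Q - a%:Q) / n.+1%:R) / 2.
  by rewrite -[n.+2%:R]natr1; field; rewrite ?[1 + _]addrC ?natr1 pnatr_eq0.
by move: (_ / n.+1%:R) h1 h2 => X h1 h2; lra.
Qed.

(** The sum over n with w = 2 i + M12, for an arbitrary dependence Phi on m_1 / 2. *)
Definition descent_inner n (sigma w : int) (Phi : rat -> qfield) : qfield :=
  \sum_(eta \in [set eta : 'cV[int]_n |
      (w + sigma * n.+1%:Z)%:Q / (2 * n.+1)%:Q + cartan_inv_1 eta \is a Num.int])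
    (let m := mvec (w%:Q *: unitvec n 1) eta in
     qpow n.+1 (quadform eta) * qbinom_vec n.+1 (m + ratvec eta) (ratvec eta)
     * Phi (component m 1 / 2)).

Lemma component1_extend n w (v : 'cV[rat]_n) : component v 1 = extend w 0 v 1.
Proof.
case: n v => [|n] v; first by rewrite component0 /extend insubF.
exact: component_extend.
Qed.

Lemma boundary_r0 n a : boundary n a 0 = a *: unitvec n 1.
Proof. by rewrite /boundary scale0r addr0. Qed.

Definition saalschutz_term n (sigma a b : int) (A B : rat) (i : int) : qfield :=
  qpow n.+1 ((i * (i + (a - b)))%:Q / n.+1%:Q)
  * qbinom n.+1 (A + B + b%:Q - i%:Q) (b - i)%:Q
  * descent_inner n sigma (2 * i + (a - b))
     (fun y => qbinom n.+1 (A + y) (i + (a - b))%:Q * qbinom n.+1 (B + y) i%:Q).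

(** As for [Xinner_neq0], now with m_1 <= w - w / N, where w = 2 i + a - b.  The
bounds on A and B are the same as on the other side, because i and i + a - b
are nonnegative. *)
Lemma saalschutz_term_neq0 n (sigma a b : int) (A B : rat) i :
  saalschutz_term n sigma a b A B i != 0 ->
  [/\ 0 <= i, 0 <= i + (a - b), i <= b, 0 <= A + (b - a)%:Q * (n.+2%:R / (2 * n.+1)%:R)
    & 0 <= B + (a - b)%:Q * (n.+2%:R / (2 * n.+1)%:R)].
Proof.
rewrite /saalschutz_term mulf_eq0 negb_or mulf_eq0 negb_or.
move=> /andP[/andP[_ /qbinom_neq0[]]]; rewrite ler0z subr_ge0 => ib _.
apply: contraNP => h; apply/eqP/fsbig1 => eta _ /=.
rewrite -boundary_r0; set mu := mvec _ _; apply/eqP; apply: contra_notT h.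
rewrite addrC => /mul4_neq0[/mvec_slopes].
rewrite -/mu /= (component1_extend (2 * i + (a - b))%:Q).
move: (extend _ _ _ 1) (extend _ _ _ n) => f1 fn /andP[h1 h2].
move=> /qbinom_neq0[a0 h3] /qbinom_neq0[b0 h4].
rewrite ler0z in a0; rewrite ler0z in b0; split=> //.
  have : 0 <= i%:Q / n.+1%:R by rewrite divr_ge0 ?ler0z ?ler0n.
  move: h1 h3; rewrite !(intrB, intrD, intrM, natrM) sub0r.
  have -> : A + (b%:Q - a%:Q) * (n.+2%:R / (2 * n.+1%:R)) =
    A - i%:Q - (a%:Q - b%:Q)+ (2 * i%:Q + (a%:Q - b%:Q)
     - (2 * i%:Q + (a%:Q - b%:Q)) / n.+1%:R) / 2 + i%:Q / n.+1%:R.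
    by rewrite -[n.+2%:R]natr1; field; rewrite ?[1 + _]addrC ?natr1 pnatr_eq0.
  by rewrite mulNr; move: (_ / n.+1%:R) (i%:Q / n.+1%:R) => X Y; lra.
have : 0 <= (i + (a - b))%:Q / n.+1%:R by rewrite divr_ge0 ?ler0z ?ler0n.
move: h1 h4; rewrite !(intrB, intrD, intrM, natrM) sub0r.
have -> : B + (a%:Q - b%:Q) * (n.+2%:R / (2 * n.+1%:R)) =
    B - i%:Q + (2 * i%:Q + (a%:Q - b%:Q)
     - (2 * i%:Q + (a%:Q - b%:Q)) / n.+1%:R) / 2 + (i%:Q + (a%:Q - b%:Q)) / n.+1%:R.
  by rewrite -[n.+2%:R]natr1; field; rewrite ?[1 + _]addrC ?natr1 pnatr_eq0.
by rewrite mulNr; move: (_ / n.+1%:R) (_ / n.+1%:R) => X Y; lra.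
Qed.

(** * The generalized q-Saalschuetz sum *)

Lemma head_path a s b : path_fun a s b 1 = head b s.
Proof. by case: s. Qed.

Lemma last_path a s b : path_fun a s b (size s) = last a s.
Proof.
rewrite /path_fun -rcons_cons nth_rcons /= ltnSn.
by rewrite -[size s]/(size (a :: s)).-1 nth_last.
Qed.

Lemma end_path a s b : path_fun a s b (size s).+1 = b.
Proof. by rewrite /path_fun /= nth_rcons ltnn eqxx. Qed.

Lemma qbinom_qbin n (t k : int) : 0 <= t ->
  qbinom n.+1 t%:Q k%:Q = qbin (qbase n.+1) t k.
Proof.
case: t => // t _; case: k => k; first exact: qbinom_nat.
rewrite qbin_neg //; apply/eqP; apply: contraTT isT => /qbinom_neq0[].
by rewrite ler0z.
Qed.

Lemma mul_div_int (x : rat) (k : int) : x != 0 -> x * (k%:Q / x) \is a Num.int.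
Proof. by move=> x0; rewrite mulrCA (divff x0) mulr1 intr_int. Qed.

Lemma halfzK z : (2 %| z)%Z -> (halfz z)%:Q = z%:Q / 2.
Proof.
move=> /dvdzP[k ->]; rewrite /halfz mulzK // intrM mulfK //.
Qed.

Lemma descent_inner_path n sg K (w : nat) (Phi : rat -> qfield) :
  (sg <= 1)%N -> (w < K)%N -> (2 %| w%:Z + sg%:Z * n.+1%:Z)%Z ->
  descent_inner n sg w Phi = qpow n.+1 (vec_shift n sg w 0)
    * \sum_(s : n.-tuple 'I_K) chain (qbase n.+1) sg n (path_fun w (map val s) 0)
        * Phi ((head 0%N (map val s))%:Q / 2).
Proof.
move=> sg01 wK par; have K0 : (0 < K)%N := leq_ltn_trans (leq0n w) wK.
have par0 : (2 %| w%:Z - 0%:Z + sg%:Z * n.+1%:Z)%Z by move: par; lia.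
rewrite /descent_inner -boundary_r0.
transitivity (\sum_(eta \in [set eta : 'cV[int]_n |
      (w%:Z - 0%:Z + sg%:Z * n.+1%:Z)%:Q / (2 * n.+1)%N%:Q + cartan_inv_1 eta \is a Num.int])
    (let mu := mvec (boundary n w%:Q 0%:Q) eta in
     qpow n.+1 (quadform eta) * qbinom_vec n.+1 (ratvec eta + mu) (ratvec eta)
     * Phi (extend w%:Q 0 mu 1 / 2))).
  rewrite subr0; apply: eq_fsbigr => eta _ /=.
  by rewrite (component1_extend w%:Q) [mvec _ _ + _]addrC.
etransitivity.
  exact: (vector_sum_path sg01 wK K0 par0 (fun mu => Phi (extend w%:Q 0 mu 1 / 2))).
congr (_ * _); apply: eq_bigr => s _.
by rewrite (extend_path w 0) // head_path.
Qed.

Section PositiveCase.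
Variables (n sg a b al be : nat).
Let N := n.+1.
Let q := qbase N.
Let K := (2 * (a + b)).+1.
Hypothesis sg01 : (sg <= 1)%N.
Hypothesis par : (2 %| a%:Z - b%:Z + sg%:Z * N%:Z)%Z.
Hypotheses (bal : (b <= al)%N) (abe : (a <= be)%N).
Hypotheses (pal : (2 %| al%:Z + a%:Z + sg%:Z)%Z) (pbe : (2 %| be%:Z + b%:Z + sg%:Z)%Z).
Let A : rat := (al%:Q - b%:Q) / 2.
Let B : rat := (be%:Q - a%:Q) / 2.

Lemma Xinner_path_sum :
  Xinner n.+1 sg a b (A + b%:Q) (B + a%:Q)
  = qpow N (vec_shift n sg a b) * path_sum q sg K n al a b be.
Proof.
have aK : (a < K)%N by rewrite /K; lia.
have bK : (b < K)%N by rewrite /K; lia.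
rewrite Xinner_extend.
pose Phi (mu : 'cV[rat]_n) :=
  qbinom n.+1 (A + b%:Q - (b%:Q - extend a%:Q b%:Q mu 1) / 2) a%:Q
   * qbinom n.+1 (B + a%:Q - (a%:Q - extend a%:Q b%:Q mu n) / 2) b%:Q.
etransitivity; first exact: (vector_sum_path sg01 aK bK par Phi).
congr (_ * _); rewrite path_sumE; apply: eq_bigr => s _; rewrite -mulrA.
have [alt|alt] := boolP (parity_steps n sg (path_fun a (map val s) b)); last first.
  by rewrite (chain_eq0 alt) !mul0r.
have sz : n = size (map val s) by rewrite size_map size_tuple.
have eh : path_fun a (map val s) b n = last a (map val s) by rewrite {2}sz last_path.
have ee : path_fun a (map val s) b n.+1 = b by rewrite {2}sz end_path.
congr (_ * _); rewrite /Phi !extend_path // head_path eh.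
have /forallP/(_ ord0) := alt; rewrite /= head_path [path_fun _ _ _ 0]/path_fun /=.
have /forallP/(_ ord_max) := alt; rewrite /= eh ee.
move: (head _ _) (last _ _) => y z pz py.
have -> : A + b%:Q - (b%:Q - y%:Q) / 2 = (halfz (al + y)%N)%:Q.
  by rewrite halfzK ?PoszD ?intrD; [rewrite /A; field|lia].
have -> : B + a%:Q - (a%:Q - z%:Q) / 2 = (halfz (z + be)%N)%:Q.
  by rewrite halfzK ?PoszD ?intrD; [rewrite /B; field|lia].
by rewrite !qbinom_qbin //; rewrite /halfz; lia.
Qed.

(** Since w^2 = 4 i (i + a - b) + (a - b)^2, the fractional powers of q on the two
sides agree. *)
Lemma vec_shift_descent (w : nat) i : w%:Z = 2 * i + (a%:Z - b%:Z) ->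
  qpow N ((i * (i + (a%:Z - b%:Z)))%:Q / N%:Q) * qpow N (vec_shift n sg w 0)
  = qpow N (vec_shift n sg a b).
Proof.
move=> wE; have parw : (2 %| w%:Z - 0%:Z + sg%:Z * N%:Z)%Z by move: par; rewrite wE; lia.
have N0 : N%:Q != 0 by rewrite -pmulrn pnatr_eq0.
rewrite -qpowD; [|exact: mul_div_int|exact: int_vec_shift].
congr (qpow _ _); rewrite /vec_shift subr0.
have -> : w%:Q = 2 * i%:Q + (a%:Q - b%:Q) by rewrite wE intrD intrM intrB.
by rewrite !(intrD, intrM, intrB) -/N; field.
Qed.

Lemma saalschutz_term_descent (w : nat) i : w%:Z = 2 * i + (a%:Z - b%:Z) -> (w < K)%N ->
  0 <= A -> 0 <= B ->
  saalschutz_term n sg a b A B i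
  = qpow N (vec_shift n sg a b) * \sum_(y < K) descent_sum q sg K n w y * end_factor q al a b be w y.
Proof.
move=> wE wK A0 B0; have K0 : (0 < K)%N by [].
have parw : (2 %| w%:Z - 0%:Z + sg%:Z * N%:Z)%Z by move: par; rewrite wE; lia.
pose Phi (y : rat) := qbinom n.+1 (A + y) (i + (a%:Z - b%:Z))%:Q * qbinom n.+1 (B + y) i%:Q.
pose phi (y : nat) := qbin q (halfz (al%:Z - b%:Z + y%:Z)) (halfz (w%:Z + a%:Z - b%:Z))
    * qbin q (halfz (be%:Z - a%:Z + y%:Z)) (halfz (w%:Z + b%:Z - a%:Z)).
have D : descent_inner n sg (2 * i + (a%:Z - b%:Z)) Phi
   = qpow N (vec_shift n sg w 0) * \sum_(y < K) descent_sum q sg K n w y * phi y.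
  rewrite -wE (descent_inner_path _ sg01 wK); last by move: parw; rewrite subr0.
  congr (_ * _); rewrite descent_sumE //; apply: eq_bigr => s _.
  have [alt|alt] := boolP (parity_steps n sg (path_fun w (map val s) 0)); last first.
    by rewrite (chain_eq0 alt) !mul0r.
  congr (_ * _).
  have /forallP/(_ ord0) := alt; rewrite /= head_path [path_fun _ _ _ 0]/path_fun /=.
  move: (head _ _) => y py; rewrite /Phi /phi.
  have hi : i = halfz (w%:Z + b%:Z - a%:Z) by rewrite wE /halfz; lia.
  have hi' : i + (a%:Z - b%:Z) = halfz (w%:Z + a%:Z - b%:Z) by rewrite wE /halfz; lia.
  have -> : A + y%:Q / 2 = (halfz (al%:Z - b%:Z + y%:Z))%:Q.
    by rewrite halfzK ?intrD ?intrB; [rewrite /A; field|lia].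
  have -> : B + y%:Q / 2 = (halfz (be%:Z - a%:Z + y%:Z))%:Q.
    by rewrite halfzK ?intrD ?intrB; [rewrite /B; field|lia].
  by rewrite hi' {1}hi !qbinom_qbin //; rewrite /halfz; lia.
rewrite /saalschutz_term [descent_inner _ _ _ _]D mulrACA (vec_shift_descent wE).
congr (_ * _); rewrite mulr_sumr; apply: eq_bigr => y _; rewrite mulrCA.
congr (_ * _); rewrite /end_factor ifT; last by lia.
rewrite /phi mulrA; congr (_ * _ * _).
have -> : A + B + b%:Q - i%:Q = (halfz (al%:Z + be%:Z - w%:Z))%:Q.
  rewrite halfzK; last by lia.
  by rewrite wE !(intrD, intrM, intrB) /A /B; field.
have ei : b%:Z - i = halfz (a%:Z + b%:Z - w%:Z) by rewrite wE /halfz; lia.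
have [ib|bi] := lerP i b%:Z; last first.
  rewrite qbin_neg; last by rewrite -ei; lia.
  apply/eqP; apply: contraTT isT => /qbinom_neq0[].
  by rewrite ler0z subr_ge0 leNgt bi.
rewrite -ei qbinom_qbin //; move: A0 B0; rewrite /A /B !pmulr_lge0 // -!intrB !ler0z.
by move: ib; rewrite /halfz; lia.
Qed.

Lemma saalschutz_path : 0 <= A -> 0 <= B ->
  Xinner n.+1 sg a b (A + b%:Q) (B + a%:Q)
  = \sum_(i \in [set: int]) saalschutz_term n sg a b A B i.
Proof.
move=> A0 B0.
rewrite Xinner_path_sum path_sum_descent ?qbase_neq0 //; last exact: qbase_not_root1.
pose idx (w : 'I_K) := halfz (w%:Z + b%:Z - a%:Z).
pose ok (w : 'I_K) := (2 %| w%:Z + a%:Z + b%:Z)%Z.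
rewrite (fsum_seq (r := [seq idx w | w <- enum ok])) //; first last.
- move=> i _ /saalschutz_term_neq0[i0 iab ib _ _].
  have wK : (absz (2 * i + (a%:Z - b%:Z))%R < K)%N by rewrite /K; lia.
  apply/mapP; exists (Ordinal wK); first by rewrite mem_enum unfold_in /ok /=; lia.
  by rewrite /idx /halfz /=; lia.
- rewrite map_inj_in_uniq ?enum_uniq // => v w; rewrite !mem_enum !unfold_in => pv pw.
  by rewrite /idx => e; apply: val_inj => /=; move: pv pw e; rewrite /ok /halfz; lia.
rewrite big_map big_enum /= /descent_side mulr_sumr [LHS](bigID ok) /=.
rewrite [X in _ + X]big1 ?addr0; last first.
  move=> w /negbTE nok; rewrite big1 ?mulr0 // => y _.
  by rewrite /end_factor; move: nok; rewrite /ok => ->; rewrite mulr0.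
apply: eq_bigr => w okw; rewrite (saalschutz_term_descent (w := w)) //.
by move: okw; rewrite /idx /ok /halfz; lia.
Qed.

End PositiveCase.

(** The last two hypotheses say that A and B are nonnegative if the necessary
conditions of [Xinner_neq0] and [saalschutz_term_neq0] hold; so either all of a,
b, A, B are nonnegative and the path identity applies, or both sides vanish. *)
Theorem generalized_saalschutz n (sg : nat) (a b : int) (A B : rat) :
  (sg <= 1)%N -> (2 %| a - b + sg%:Z * n.+1%:Z)%Z ->
  A + (a - b + sg%:Z)%:Q / 2 \is a Num.int -> B + (a - b + sg%:Z)%:Q / 2 \is a Num.int ->
  (0 <= A + (b - a)%:Q * (n.+2%:R / (2 * n.+1)%:R) -> 0 <= A) ->
  (0 <= B + (a - b)%:Q * (n.+2%:R / (2 * n.+1)%:R) -> 0 <= B) ->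
  Xinner n.+1 sg a b (A + b%:Q) (B + a%:Q)
  = \sum_(i \in [set: int]) saalschutz_term n sg a b A B i.
Proof.
move=> sg01 par Aint Bint condA condB.
have [ok|bad] := boolP [&& 0 <= a, 0 <= b, 0 <= A & 0 <= B]; last first.
  transitivity (0 : qfield).
    apply/eqP; apply: contraNT bad => /Xinner_neq0[-> -> /condA -> /condB ->] //.
  symmetry; apply: fsbig1 => i _; apply/eqP; apply: contraNT bad.
  move=> /saalschutz_term_neq0[i0 iab ib /condA -> /condB ->].
  by rewrite !andbT; apply/andP; split; lia.
case/and4P: ok; case: a par Aint Bint condA condB => // {}a par Aint Bint _ _ _.
case: b par Aint Bint => // {}b par Aint Bint _ A0 B0.
have [al alE pal] : exists2 al : nat, A = (al%:Q - b%:Q) / 2 & (2 %| al%:Z + a%:Z + sg%:Z)%Z.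
  case/intrP: Aint => k kE.
  have e : 2 * A + b%:Q = (2 * k - a%:Z + 2 * b%:Z - sg%:Z)%:Q.
    by rewrite !(intrB, intrD, intrM) -kE !(intrB, intrD); field.
  have pos : 0 <= 2 * k - a%:Z + 2 * b%:Z - sg%:Z.
    by rewrite -(ler0z rat) -e addr_ge0 ?mulr_ge0 ?ler0z.
  exists (absz (2 * k - a%:Z + 2 * b%:Z - sg%:Z)%R); last by lia.
  by rewrite gez0_abs // -e; field.
have [be beE pbe] : exists2 be : nat, B = (be%:Q - a%:Q) / 2 & (2 %| be%:Z + b%:Z + sg%:Z)%Z.
  case/intrP: Bint => k kE.
  have e : 2 * B + a%:Q = (2 * k + b%:Z - sg%:Z)%:Q.
    by rewrite !(intrB, intrD, intrM) -kE !(intrB, intrD); field.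
  have pos : 0 <= 2 * k + b%:Z - sg%:Z.
    by rewrite -(ler0z rat) -e addr_ge0 ?mulr_ge0 ?ler0z.
  exists (absz (2 * k + b%:Z - sg%:Z)%R); last by lia.
  by rewrite gez0_abs // -e; field.
move: A0 B0; rewrite alE beE => A0 B0.
apply: saalschutz_path => //.
  by move: A0; rewrite pmulr_lge0 // -intrB ler0z; lia.
by move: B0; rewrite pmulr_lge0 // -intrB ler0z; lia.
Qed.

(** * Summation over i and j *)

(** For an integer j, the inequality 0 <= x - D j means j <= floor (x / D). *)
Lemma floor_transfer (x y D d : rat) (j : int) : 0 < D -> 0 < d ->
  Num.floor (x / D) <= Num.floor (y / d) -> 0 <= x - D * j%:Q -> 0 <= y - d * j%:Q.
Proof.
move=> D0 d0 h; rewrite !subr_ge0 ![_ * j%:Q]mulrC -!ler_pdivlMr // => jx.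
by rewrite -floor_ge_int (le_trans _ h) // floor_ge_int.
Qed.

Definition int_range (R : nat) : seq int := [seq k%:Z - R%:Z | k <- iota 0 (2 * R).+1].

Lemma mem_int_range R i : (i \in int_range R) = (- R%:Z <= i <= R%:Z).
Proof.
apply/mapP/idP => [[k]|/andP[lo hi]].
  by rewrite mem_iota => /andP[_ k1] ->; lia.
by exists (absz (i + R%:Z)%R); [rewrite mem_iota|]; lia.
Qed.

Lemma int_range_uniq R : uniq (int_range R).
Proof. by rewrite map_inj_uniq ?iota_uniq // => x y; lia. Qed.

(** Each side is a triple sum over i, j and x; the hypotheses compare the factors
that precede the terms g1 and g2. *)
Lemma exchange_terms (R : comNzRingType) (X : Type) (rI rJ : seq int)
    (rx : int -> seq X) (wt : X -> R) (c e1 e2 q1 q2 : int -> R)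
    (u1 u2 : int -> int -> R) (g1 g2 : int -> int -> X -> R) :
  (forall i j, q1 j * u1 i j = c i * e1 j) -> (forall i j, q2 j * u2 i j = c i * e2 j) ->
  \sum_(j <- rJ) q1 j * \sum_(i <- rI) u1 i j * \sum_(x <- rx i) wt x * g1 i j x
  - \sum_(j <- rJ) q2 j * \sum_(i <- rI) u2 i j * \sum_(x <- rx i) wt x * g2 i j x
  = \sum_(i <- rI) c i * \sum_(x <- rx i) wt x * \sum_(j <- rJ) (e1 j * g1 i j x - e2 j * g2 i j x).
Proof.
move=> h1 h2.
have E q u e g : (forall i j, q j * u i j = c i * e j) ->
  \sum_(j <- rJ) q j * \sum_(i <- rI) u i j * \sum_(x <- rx i) wt x * g i j x
  = \sum_(i <- rI) \sum_(x <- rx i) \sum_(j <- rJ) c i * (wt x * (e j * g i j x)).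
  move=> h; rewrite (eq_bigr (fun j => \sum_(i <- rI) \sum_(x <- rx i) c i * (wt x * (e j * g i j x)))).
    by rewrite exchange_big; apply: eq_bigr => i _; rewrite exchange_big.
  move=> j _; rewrite mulr_sumr; apply: eq_bigr => i _.
  by rewrite mulrA h mulr_sumr; apply: eq_bigr => x _; ring.
rewrite (E q1 u1 e1 g1 h1) (E q2 u2 e2 g2 h2) -sumrB; apply: eq_bigr => i _.
rewrite -sumrB mulr_sumr; apply: eq_bigr => x _.
by rewrite -sumrB !mulr_sumr; apply: eq_bigr => j _; ring.
Qed.

(** The weights of the sum over n have finite support, whatever Phi is; this makes
the sum linear in Phi, and the sum over j in Phi can be taken out. *)
Lemma descent_inner_finite n (sg : nat) (w : int) : (sg <= 1)%N ->
  0 <= w -> (2 %| w + sg%:Z * n.+1%:Z)%Z ->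
  exists r : seq (qfield * rat), forall Phi,
    descent_inner n sg w Phi = \sum_(x <- r) x.1 * Phi x.2.
Proof.
case: w => // w sg01 _ par.
exists [seq (qpow n.+1 (vec_shift n sg w 0)
     * chain (qbase n.+1) sg n (path_fun w (map val s) 0),
   (head 0%N (map val s))%:Q / 2) | s : n.-tuple 'I_w.+1 <- enum {: n.-tuple 'I_w.+1}] => Phi.
rewrite big_map big_enum /= (descent_inner_path Phi sg01 (ltnSn w) par) mulr_sumr.
by apply: eq_bigr => s _; rewrite mulrA.
Qed.

Lemma descent_inner0 n sigma w Phi : (forall y, Phi y = 0) -> descent_inner n sigma w Phi = 0.
Proof. by move=> P0; apply: fsbig1 => eta _; rewrite /= P0 mulr0. Qed.

Definition qbinom_pair n (A B : rat) (x z : int) (y : rat) : qfield :=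
  qbinom n.+1 (A + y) x%:Q * qbinom n.+1 (B + y) z%:Q.

Lemma qbinom_pair_neq0 n A B x z y : qbinom_pair n A B x z y != 0 -> 0 <= x /\ 0 <= z.
Proof.
rewrite /qbinom_pair mulf_eq0 negb_or => /andP[/qbinom_neq0[x0 _] /qbinom_neq0[z0 _]].
by move: x0 z0; rewrite !ler0z.
Qed.

(** For i outside this range all the terms of both sides vanish, whatever the
shift k is. *)
Definition index_range (M1 M2 : int) : seq int :=
  [seq i <- int_range (absz M1 + absz M2)%N | (0 <= 2 * i + (M1 - M2)) && (i <= M2)].

Lemma mem_index_range M1 M2 i :
  (i \in index_range M1 M2) = (0 <= 2 * i + (M1 - M2)) && (i <= M2).
Proof. by rewrite mem_filter mem_int_range; lia. Qed.

Section Shift.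
Variables (n sg : nat) (M1 M2 : int).
Let N := n.+1.
Let M12 := M1 - M2.
Hypothesis sg01 : (sg <= 1)%N.
Hypothesis par : (2 %| M12 + sg%:Z * N%:Z)%Z.

Lemma shifted_saalschutz (k : int) (A B : rat) :
  A + (M12 + sg%:Z)%:Q / 2 \is a Num.int -> B + (M12 + sg%:Z)%:Q / 2 \is a Num.int ->
  (0 <= A - (M12 + 2 * k)%:Q * (n.+2%:R / (2 * n.+1)%:R) -> 0 <= A) ->
  (0 <= B + (M12 + 2 * k)%:Q * (n.+2%:R / (2 * n.+1)%:R) -> 0 <= B) ->
  Xinner N sg (M1 + k) (M2 - k) (A + (M2 - k)%:Q) (B + (M1 + k)%:Q)
  = \sum_(i <- index_range M1 M2)
     (qpow N (((i - k) * (i + M12 + k))%:Q / N%:Q) * qbinom N (A + B + M2%:Q - i%:Q) (M2 - i)%:Q)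
     * descent_inner n sg (2 * i + M12) (qbinom_pair n A B (i + M12 + k) (i - k)).
Proof.
move=> Aint Bint condA condB.
have abE : M1 + k - (M2 - k) = M12 + 2 * k by rewrite /M12; ring.
have baE : M2 - k - (M1 + k) = - (M12 + 2 * k) by rewrite /M12; ring.
have halves x : x + (M12 + sg%:Z)%:Q / 2 \is a Num.int ->
    x + (M12 + 2 * k + sg%:Z)%:Q / 2 \is a Num.int.
  move=> xi; rewrite (_ : _ + _ = x + (M12 + sg%:Z)%:Q / 2 + k%:Q); first by rewrite rpredD ?intr_int.
  by rewrite !(intrD, intrM); field.
rewrite generalized_saalschutz //; first last.
- by rewrite abE.
- by rewrite baE intrN mulNr.
- by rewrite abE; apply: halves.
- by rewrite abE; apply: halves.
- by rewrite abE; move: par; lia.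
rewrite (reindex_fsbigT (fun i : int => i - k)); last first.
  by exists (fun i => i + k) => i; rewrite ?addrK ?subrK.
have e i : saalschutz_term n sg (M1 + k) (M2 - k) A B (i - k) =
     (qpow N (((i - k) * (i + M12 + k))%:Q / N%:Q) * qbinom N (A + B + M2%:Q - i%:Q) (M2 - i)%:Q)
     * descent_inner n sg (2 * i + M12) (qbinom_pair n A B (i + M12 + k) (i - k)).
  rewrite /saalschutz_term abE.
  have -> : i - k + (M12 + 2 * k) = i + M12 + k by ring.
  have -> : M2 - k - (i - k) = M2 - i by ring.
  have -> : 2 * (i - k) + (M12 + 2 * k) = 2 * i + M12 by ring.
  by have -> : A + B + (M2 - k)%:Q - (i - k)%:Q = A + B + M2%:Q - i%:Q by rewrite !intrB; ring.
rewrite (@fsum_seq _ _ _ (index_range M1 M2)).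
- by apply: eq_bigr => i _; apply: e.
- exact: filter_uniq (int_range_uniq _).
- by [].
- move=> i _ /saalschutz_term_neq0[i0 iab ib _ _]; rewrite mem_index_range.
  by move: iab; rewrite abE /M12; lia.
Qed.

End Shift.

Lemma qpow_frac n (a b c e : int) : a + b = c + n.+1%:Z * e ->
  qpow n.+1 (a%:Q / n.+1%:Q) * qpow n.+1 (b%:Q / n.+1%:Q)
  = qpow n.+1 (c%:Q / n.+1%:Q) * qpow n.+1 e%:Q.
Proof.
move=> h; have N0 : n.+1%:Q != 0 by rewrite -pmulrn pnatr_eq0.
rewrite -!qpowD; first last.
- exact: mul_div_int.
- exact: mul_div_int.
- by rewrite -intrM intr_int.
- exact: mul_div_int.
congr (qpow _ _); rewrite -mulrDl -intrD h intrD intrM.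
by move: N0; move: (n.+1%:Q) => x x0; field.
Qed.

Lemma mulr_neq0r (R : idomainType) (x y : R) : x * y != 0 -> y != 0.
Proof. by rewrite mulf_eq0 negb_or => /andP[]. Qed.

Section Branch.
Variables (n : nat) (M12 p p' r s j : int) (L : rat).
Hypotheses (hp : 1 <= p) (hpp' : p < p').
Let N : rat := n.+1%:Q.
Let c : rat := M12%:Q * (N - 1) / (2 * n.+1)%:Q.
Let D : rat := p'%:Q + p%:Q / N.
Let d : rat := (p' - p)%:Q.

(** The quantity assumed nonnegative is L + c - s - r / N - D j. *)
Lemma branch_nonneg_l :
  Num.floor ((L + c - s%:Q - r%:Q / N) / D) <= Num.floor ((L + M12%:Q + r%:Q - s%:Q) / d) ->
  0 <= L + M12%:Q + r%:Q - s%:Q - d * j%:Q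
      - (M12 + 2 * (p * j + r))%:Q * (n.+2%:R / (2 * n.+1)%:R) ->
  0 <= L + M12%:Q + r%:Q - s%:Q - d * j%:Q.
Proof.
have N0 : 0 < N by rewrite /N ltr0z.
move=> h pos; apply: (floor_transfer _ _ h).
- by rewrite addr_gt0 ?divr_gt0 // ltr0z; lia.
- by rewrite ltr0z; lia.
move: pos; congr (_ <= _).
rewrite /c /D /d !(intrD, intrM, intrB) natrM -[n.+2%:R]natr1 -[n.+1%:R]/N.
rewrite (_ : (2 * n.+1)%:Q = 2 * N); last by rewrite /N PoszM intrM.
by field; rewrite addrC natr1 pnatr_eq0.
Qed.

(** The quantity assumed nonnegative is L - c + s + r / N + D j. *)
Lemma branch_nonneg_r :
  Num.floor ((L - c + s%:Q + r%:Q / N) / D) <= Num.floor ((L - M12%:Q - r%:Q + s%:Q) / d) ->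
  0 <= L - M12%:Q - r%:Q + s%:Q + d * j%:Q
      + (M12 + 2 * (p * j + r))%:Q * (n.+2%:R / (2 * n.+1)%:R) ->
  0 <= L - M12%:Q - r%:Q + s%:Q + d * j%:Q.
Proof.
have N0 : 0 < N by rewrite /N ltr0z.
move=> h pos.
suff : 0 <= L - M12%:Q - r%:Q + s%:Q - d * (- j)%:Q by rewrite intrN mulrN opprK.
apply: (floor_transfer _ _ h).
- by rewrite addr_gt0 ?divr_gt0 // ltr0z; lia.
- by rewrite ltr0z; lia.
move: pos; congr (_ <= _).
rewrite /c /D /d !(intrD, intrM, intrB, intrN) natrM -[n.+2%:R]natr1 -[n.+1%:R]/N.
rewrite (_ : (2 * n.+1)%:Q = 2 * N); last by rewrite /N PoszM intrM.
by field; rewrite addrC natr1 pnatr_eq0.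
Qed.

End Branch.

Theorem mainTheorem2 (N : nat) (sigma M1 M2 : int) (L1 L2 : rat)
    (p p' r s : int)
    (hN : (1 <= N)%N)
    (hsigma : sigma = 0 \/ sigma = 1)
    (hL1 : L1 + (M1 - M2 + sigma)%:Q / 2%:Q \is a Num.int)
    (hL2 : L2 + (M1 - M2 + sigma)%:Q / 2%:Q \is a Num.int)
    (hpar : (2 %| M1 - M2 + sigma * N%:Z)%Z)
    (hp : 1 <= p) (hpp' : p < p') :
  let M12 := M1 - M2 in
  let c : rat := M12%:Q * (N%:Q - 1) / (2 * N)%:Q in
  let D : rat := p'%:Q + p%:Q / N%:Q in
  let d : rat := (p' - p)%:Q in
  Num.floor ((L1 + c - s%:Q - r%:Q / N%:Q) / D)
    <= Num.floor ((L1 + M12%:Q + r%:Q - s%:Q) / d) ->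
  Num.floor ((L2 - c + s%:Q + r%:Q / N%:Q) / D)
    <= Num.floor ((L2 - M12%:Q - r%:Q + s%:Q) / d) ->
  Num.floor ((L1 + c) / D) <= Num.floor ((L1 + M12%:Q) / d) ->
  Num.floor ((L2 - c) / D) <= Num.floor ((L2 - M12%:Q) / d) ->
  XNpoly p (p + N%:Z * p') N r (r + N%:Z * s) sigma M1 L1 M2 L2
  = \sum_(i \in [set: int])
      (qpow N ((i * (i + M12))%:Q / N%:Q)
       * qbinom N (L1 + L2 + M2%:Q - i%:Q) (M2 - i)%:Q
       * \sum_(n \in [set n : 'cV[int]_N.-1 |
             (2 * i + M12 + sigma * N%:Z)%:Q / (2 * N)%:Q + cartan_inv_1 n
               \is a Num.int])
           (let m := mvec ((2 * i + M12)%:Q *: unitvec N.-1 1) n in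
            qpow N (quadform n)
            * qbinom_vec N (m + ratvec n) (ratvec n)
            * Xpoly N p p' r s
                (i + M12) (L1 - i%:Q + component m 1 / 2%:Q)
                i (L2 - M12%:Q - i%:Q + component m 1 / 2%:Q))).
Proof.
case: N hN hpar => [//|n] _ hpar M12 c D d h1 h2 h3 h4.
have [sg sg01 sE] : exists2 sg : nat, (sg <= 1)%N & sigma = sg.
  by case: hsigma => ->; [exists 0%N | exists 1%N].
rewrite {hsigma}sE in hL1 hL2 hpar *.
(* The first sum over j corresponds to (r0, s0) = (0, 0), the second one to
   (r0, s0) = (r, s). *)
pose k (r0 : int) (j : int) := p * j + r0.
pose A (r0 s0 : int) (j : int) := L1 + M12%:Q + r0%:Q - s0%:Q - d * j%:Q.
pose B (r0 s0 : int) (j : int) := L2 - M12%:Q - r0%:Q + s0%:Q + d * j%:Q.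
pose J := (absz M1 + absz M2 + absz r)%N.
pose Qb i := qbinom n.+1 (L1 + L2 + M2%:Q - i%:Q) (M2 - i)%:Q.
pose rI := index_range M1 M2.
have N_neq0 : n.+1%:Q != 0 by rewrite -pmulrn pnatr_eq0.
have [rx rxE] : exists rx : int -> seq (qfield * rat), forall i, i \in rI -> forall Phi,
    descent_inner n sg (2 * i + M12) Phi = \sum_(x <- rx i) x.1 * Phi x.2.
  suff : forall i, exists r : seq (qfield * rat), i \in rI -> forall Phi,
    descent_inner n sg (2 * i + M12) Phi = \sum_(x <- r) x.1 * Phi x.2.
    by move=> /choice[f fE]; exists f.
  move=> i; have [iI|niI] := boolP (i \in rI); last by exists [::].
  have par_i : (2 %| 2 * i + M12 + sg%:Z * n.+1%:Z)%Z by move: hpar; rewrite /M12; lia.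
  have w0 : 0 <= 2 * i + M12 by move: iI; rewrite mem_index_range => /andP[].
  by have [r0 r0E] := descent_inner_finite sg01 w0 par_i; exists r0.
pose u (r0 : int) i j := qpow n.+1 (((i - k r0 j) * (i + M12 + k r0 j))%:Q / n.+1%:Q) * Qb i.
pose g r0 s0 i j (x : qfield * rat) :=
  qbinom_pair n (A r0 s0 j) (B r0 s0 j) (i + M12 + k r0 j) (i - k r0 j) x.2.
have branch r0 s0 j t1 t2 :
  Num.floor ((L1 + c - s0%:Q - r0%:Q / n.+1%:Q) / D)
    <= Num.floor ((L1 + M12%:Q + r0%:Q - s0%:Q) / d) ->
  Num.floor ((L2 - c + s0%:Q + r0%:Q / n.+1%:Q) / D)
    <= Num.floor ((L2 - M12%:Q - r0%:Q + s0%:Q) / d) ->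
  t1 = A r0 s0 j + (M2 - k r0 j)%:Q -> t2 = B r0 s0 j + (M1 + k r0 j)%:Q ->
  Xinner n.+1 sg (M1 + k r0 j) (M2 - k r0 j) t1 t2
  = \sum_(i <- rI) u r0 i j * \sum_(x <- rx i) x.1 * g r0 s0 i j x.
  move=> hA hB -> ->; rewrite (shifted_saalschutz sg01 hpar).
  - rewrite big_seq [RHS]big_seq; apply: eq_bigr => i iI; rewrite /u /Qb rxE //.
    by have -> : A r0 s0 j + B r0 s0 j = L1 + L2 by rewrite /A /B; ring.
  - rewrite (_ : _ + _ = L1 + (M12 + sg%:Z)%:Q / 2 + (M12 + r0 - s0 - (p' - p) * j)%:Q).
      by rewrite rpredD ?intr_int.
    by rewrite /A /d /M12 !(intrN, intrD, intrM); ring.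
  - rewrite (_ : _ + _ = L2 + (M12 + sg%:Z)%:Q / 2 + (s0 - M12 - r0 + (p' - p) * j)%:Q).
      by rewrite rpredD ?intr_int.
    by rewrite /B /d /M12 !(intrN, intrD, intrM); ring.
  - exact: branch_nonneg_l hA.
  - exact: branch_nonneg_r hB.
(* q1, e1 and q2, e2 are the powers of q in the sums over j on the left and on
   the right; cc i is the factor in front of the sum over n. *)
pose e1 j := qpow n.+1 (j * (p * p' * j + p' * (M12 + r) - p * s))%:Q.
pose e2 j := qpow n.+1 ((p * j + M12 + r) * (p' * j + s))%:Q.
pose P := p + n.+1%:Z * p'.
pose q1 j := qpow n.+1 (j%:Q / n.+1%:Q * (p * P * j + P * (M12 + r) - p * (r + n.+1%:Z * s))%:Q).
pose q2 j := qpow n.+1 (((p * j + M12 + r) * (P * j + (r + n.+1%:Z * s)))%:Q / n.+1%:Q).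
pose cc i := qpow n.+1 ((i * (i + M12))%:Q / n.+1%:Q) * Qb i.
have h1' : Num.floor ((L1 + c - 0%:Q - 0%:Q / n.+1%:Q) / D)
    <= Num.floor ((L1 + M12%:Q + 0%:Q - 0%:Q) / d) by rewrite !(mul0r, subr0, addr0).
have h2' : Num.floor ((L2 - c + 0%:Q + 0%:Q / n.+1%:Q) / D)
    <= Num.floor ((L2 - M12%:Q - 0%:Q + 0%:Q) / d) by rewrite !(mul0r, subr0, addr0).
(* since p >= 1, the index j is bounded by p j *)
have k_range r0 j : `|r0| <= `|r| -> `|k r0 j| <= `|M1| + `|M2| -> j \in int_range J.
  have : `|j| <= `|p * j| by rewrite normrM ler_peMl // ger0_norm; lia.
  by rewrite mem_int_range /J /k; lia.
have left_branch r0 s0 (qq : int -> qfield) :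
  Num.floor ((L1 + c - s0%:Q - r0%:Q / n.+1%:Q) / D)
    <= Num.floor ((L1 + M12%:Q + r0%:Q - s0%:Q) / d) ->
  Num.floor ((L2 - c + s0%:Q + r0%:Q / n.+1%:Q) / D)
    <= Num.floor ((L2 - M12%:Q - r0%:Q + s0%:Q) / d) ->
  `|r0| <= `|r| ->
  \sum_(j \in [set: int]) (qq j * Xinner n.+1 sg (M1 + p * j + r0) (M2 - p * j - r0)
     (M1%:Q + L1 - ((P - p) * j - r0 + (r0 + n.+1%:Z * s0))%:Q / n.+1%:Q)
     (M2%:Q + L2 + ((P - p) * j - r0 + (r0 + n.+1%:Z * s0))%:Q / n.+1%:Q))
  = \sum_(j <- int_range J) qq j * \sum_(i <- rI) u r0 i j * \sum_(x <- rx i) x.1 * g r0 s0 i j x.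
  move=> hA hB r0r.
  have kl j : M1 + p * j + r0 = M1 + k r0 j by rewrite /k addrA.
  have kr j : M2 - p * j - r0 = M2 - k r0 j by rewrite /k opprD addrA.
  have tE j : ((P - p) * j - r0 + (r0 + n.+1%:Z * s0))%:Q / n.+1%:Q = p'%:Q * j%:Q + s0%:Q.
    rewrite (_ : _ + _ = n.+1%:Z * (p' * j + s0)); last by rewrite /P; ring.
    by rewrite intrM mulrAC divff // mul1r intrD intrM.
  have t1E j : M1%:Q + L1 - ((P - p) * j - r0 + (r0 + n.+1%:Z * s0))%:Q / n.+1%:Q
      = A r0 s0 j + (M2 - k r0 j)%:Q.
    by rewrite tE /A /d /k /M12 !(intrN, intrD, intrM); ring.
  have t2E j : M2%:Q + L2 + ((P - p) * j - r0 + (r0 + n.+1%:Z * s0))%:Q / n.+1%:Q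
      = B r0 s0 j + (M1 + k r0 j)%:Q.
    by rewrite tE /B /d /k /M12 !(intrN, intrD, intrM); ring.
  rewrite (@fsum_seq _ _ _ (int_range J)).
  - by apply: eq_bigr => j _; rewrite -(branch _ _ _ _ _ hA hB (t1E j) (t2E j)) kl kr.
  - exact: int_range_uniq.
  - by [].
  - move=> j _ /mulr_neq0r; rewrite kl kr t1E t2E => /Xinner_neq0[a0 b0 _ _].
    by apply: (k_range r0) => //; lia.
have left : XNpoly p P n.+1 r (r + n.+1%:Z * s) sg M1 L1 M2 L2
  = \sum_(j <- int_range J) q1 j * \sum_(i <- rI) u 0 i j * \sum_(x <- rx i) x.1 * g 0 0 i j x
  - \sum_(j <- int_range J) q2 j * \sum_(i <- rI) u r i j * \sum_(x <- rx i) x.1 * g r s i j x.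
  rewrite -(left_branch _ _ _ h1 h2) // -(left_branch _ _ _ h1' h2') ?normr0 //.
  rewrite /XNpoly -/M12; congr (_ - _); apply: eq_fsbigr => j _.
  by rewrite !(mulr0, addr0, subr0).
pose X i y := Xpoly n.+1 p p' r s (i + M12) (L1 - i%:Q + y) i (L2 - M12%:Q - i%:Q + y).
pose G r0 s0 i j y := qbinom_pair n (A r0 s0 j) (B r0 s0 j) (i + M12 + k r0 j) (i - k r0 j) y.
have XE i y : X i y = \sum_(j \in [set: int]) (e1 j * G 0 0 i j y - e2 j * G r s i j y).
  rewrite /X /Xpoly; apply: eq_fsbigr => j _.
  have -> : i + M12 - i = M12 by ring.
  have aE r0 s0 : (i + M12)%:Q + (L1 - i%:Q + y) - ((p' - p) * j)%:Q + (r0 - s0)%:Q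
      = A r0 s0 j + y.
    by rewrite /A /d !(intrN, intrD, intrM); ring.
  have bE r0 s0 : i%:Q + (L2 - M12%:Q - i%:Q + y) + ((p' - p) * j)%:Q - (r0 - s0)%:Q
      = B r0 s0 j + y.
    by rewrite /B /d !(intrN, intrD, intrM); ring.
  have a0 := aE 0 0; have b0 := bE 0 0; rewrite subrr addr0 in a0; rewrite subrr subr0 in b0.
  have lE : i + M12 + k r j = i + M12 + p * j + r by rewrite /k; ring.
  have uE : i - k r j = i - p * j - r by rewrite /k; ring.
  have k0 : k 0 j = p * j by rewrite /k addr0.
  by rewrite aE bE a0 b0 /G /qbinom_pair lE uE k0 /e1 /e2 -!mulrA.
have Gneq0 r0 s0 i j y : i <= M2 -> G r0 s0 i j y != 0 ->
    (0 <= 2 * i + M12) /\ (`|k r0 j| <= `|M1| + `|M2|).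
  by move=> iM /qbinom_pair_neq0; move: iM; rewrite /M12; lia.
transitivity (\sum_(i <- rI) cc i * \sum_(x <- rx i) x.1
    * \sum_(j <- int_range J) (e1 j * g 0 0 i j x - e2 j * g r s i j x)).
  rewrite left; apply: exchange_terms => i j; rewrite /u /cc mulrA [RHS]mulrAC; congr (_ * _).
    rewrite /q1 [_ / _ * _]mulrAC -intrM; apply: qpow_frac; rewrite /k /P; ring.
  by apply: qpow_frac; rewrite /k /P; ring.
symmetry; rewrite (@fsum_seq _ _ _ rI).
- rewrite big_seq [RHS]big_seq; apply: eq_bigr => i iI.
  congr (_ * _); etransitivity; first exact: (rxE i iI (X i)).
  apply: eq_bigr => x _; congr (_ * _).
  have iM : i <= M2 by move: iI; rewrite mem_index_range => /andP[].
  rewrite XE (@fsum_seq _ _ _ (int_range J)).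
  + by [].
  + exact: int_range_uniq.
  + by [].
  + move=> j _; apply: contraNT => jJ; apply/eqP.
    have z r0 s0 : `|r0| <= `|r| -> G r0 s0 i j x.2 = 0.
      move=> r0r; apply/eqP; apply: contraNT jJ => /(Gneq0 _ _ _ _ _ iM)[_].
      exact: k_range.
    by rewrite !z ?normr0 // !mulr0 subrr.
- exact: filter_uniq (int_range_uniq _).
- by [].
- move=> i _; rewrite mem_index_range -/M12; apply: contraNT; rewrite negb_and -!ltNge => out.
  have [Mi|iM] := ltrP M2 i.
    rewrite (_ : qbinom _ _ _ = 0) ?mulr0 ?mul0r //.
    apply/eqP; apply: contraTT Mi => /qbinom_neq0[].
    by rewrite ler0z subr_ge0 -leNgt.
  have X0 y : X i y = 0.
    rewrite XE; apply: fsbig1 => j _.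
    have z r0 s0 : G r0 s0 i j y = 0.
      apply/eqP; apply: contraTT isT => /(Gneq0 _ _ _ _ _ iM)[w0 _].
      by move: out; rewrite ltNge w0 /= ltNge iM.
    by rewrite !z !mulr0 subrr.
  apply/eqP; rewrite [X in _ * X](_ : _ = 0) ?mulr0 //.
  exact: (@descent_inner0 n sg (2 * i + M12) (X i) X0).
Qed.
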